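(* Let $m,n\in\mathbb{N}_0$ with $m\neq n$, and let $\Phi$ be an algebraically closed field of characteristic $0$. There is no simple finite-dimensional Filippov superalgebra $\mathcal{F}$ over $\Phi$ (of any arity $N\ge 3$, with nonzero even and odd parts) of type $A(m,n)$ such that $\mathcal{F}$ is a highest weight module over $A(m,n)$.
   Context: $\mathbb{N}_0=\{0,1,2,\dots\}$. An $N$-ary Filippov superalgebra over a field $k$ is a $\mathbb{Z}_2$-graded vector space $\mathcal{F}=\mathcal{F}_{\bar 0}\oplus\mathcal{F}_{\bar 1}$ over $k$ with an $N$-linear operation $[\cdot,\ldots,\cdot]$ such that $[\mathcal{F}_{\alpha_1},\ldots,\mathcal{F}_{\alpha_N}]\subseteq\mathcal{F}_{\alpha_1+\cdots+\alpha_N}$ and, for homogeneous elements (with $p(x)$ denoting the parity of $x$), $$[x_1,\ldots,x_{i-1},x_i,\ldots,x_N]=-(-1)^{p(x_{i-1})p(x_i)}[x_1,\ldots,x_i,x_{i-1},\ldots,x_N],$$ $$[[x_1,\ldots,x_N],y_2,\ldots,y_N]=\sum_{i=1}^N(-1)^{p\bar q_i}[x_1,\ldots,[x_i,y_2,\ldots,y_N],\ldots,x_N],$$ where $p=\sum_{i=2}^Np(y_i)$, $\bar q_i=\sum_{j=i+1}^Np(x_j)$, $\bar q_N=0$. An ideal of $\mathcal{F}$ is a $\mathbb{Z}_2$-graded subspace $I$ with $[I,\mathcal{F},\ldots,\mathcal{F}]\subseteq I$. $\mathcal{F}$ is simple if $[\mathcal{F},\ldots,\mathcal{F}]\neq 0$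 and $\mathcal{F}$ has no ideals other than $0$ and $\mathcal{F}$. For homogeneous $x_1,\ldots,x_{N-1}\in\mathcal{F}$ and $i\in\{1,\ldots,N\}$ let $ad_i(x_1,\ldots,x_{N-1})\in End(\mathcal{F})$ be given by $ad_i(x_1,\ldots,x_{N-1})x=(-1)^{p(x)q_i}[x_1,\ldots,x_{i-1},x,x_i,\ldots,x_{N-1}]$, $q_i=\sum_{j=i}^{N-1}p(x_j)$. $Inder(\mathcal{F})$ is the linear span of all these operators; it is a Lie superalgebra under the supercommutator $[a,b]=ab-(-1)^{\deg(a)\deg(b)}ba$. $\mathcal{F}$ is said to have type $G$, for a Lie superalgebra $G$, if $Inder(\mathcal{F})\cong G$; then $\mathcal{F}$ is regarded as a $G$-module via this isomorphism. For $m\neq n$, $A(m,n)=sl(m+1,n+1)$ is the Lie superalgebra (under the supercommutator) of block matrices $\begin{pmatrix}A&B\\C&D\end{pmatrix}$ with $A$ of size $(m+1)\times(m+1)$, $D$ of size $(n+1)\times(n+1)$, and $tr(A)=tr(D)$; the even part is $B=C=0$ and the odd part is $A=D=0$. Let $H$ be the subalgebra of diagonal matrices, $N^+$ the span of the matrix units $e_{kl}$ with $k<l$, and $B=H\oplus N^+$. For $\Lambda\in H^*$, the highest weight module with highest weight $\Lambda$ is $V_\Lambda=Ind_B^{G}\langle v_\Lambda\rangle/I_\Lambda$, where $G=A(m,n)$, $\langle v_\Lambda\rangle$ is the one-dimensional $B$-module with $N^+v_\Lambda=0$ and $hv_\Lambda=\Lambda(h)v_\Lambda$ for $h\in H$,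 $Ind_B^G\langle v_\Lambda\rangle=U(G)\otimes_{U(B)}\langle v_\Lambda\rangle$, and $I_\Lambda$ is its unique maximal submodule; $1\otimes v_\Lambda$ may be declared even or odd. *)

(* Defs.v *)
From HB Require Import structures.
From mathcomp Require Import all_boot all_order perm all_algebra.
From mathcomp Require Import boolp monalg.

Set Implicit Arguments.
Unset Strict Implicit.
Unset Printing Implicit Defensive.

Import GRing.Theory.
Local Open Scope ring_scope.
Local Open Scope quotient_scope.

(* Parities are booleans: false is even, true is odd, and addb is addition in
   Z/2.  Zero belongs to both homogeneous components, so a parity is always
   quantified together with the homogeneous element that carries it. *)

(** * Filippov superalgebras *)

Section Slots.
Variables (T : Type) (N : nat).

Definition upd (x : {ffun 'I_N -> T}) (i : 'I_N) (a : T) : {ffun 'I_N -> T} :=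
  [ffun j => if j == i then a else x j].

(* [insert i a y] lists the N - 1 entries of y in order, with a added so that
   it occupies position i. *)
Definition insert (i : 'I_N) (a : T) (y : {ffun 'I_N.-1 -> T}) :
    {ffun 'I_N -> T} :=
  [ffun j => if unlift i j is Some k then y k else a].

Definition exchange (i j : 'I_N) (x : {ffun 'I_N -> T}) : {ffun 'I_N -> T} :=
  [ffun k => x (tperm i j k)].

End Slots.

(* In [filippov_identity], i0 is the first position and the N - 1 entries of y
   are y_2, ..., y_N. *)
Record filippovSuperalgebra (K : fieldType) (N : nat) := FilippovSuperalgebra {
  fs_sort :> vectType K;
  fs_gr : bool -> {vspace fs_sort};
  fs_br : {ffun 'I_N -> fs_sort} -> fs_sort;
  fs_gr_sum : (fs_gr false + fs_gr true = fullv)%VS;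
  fs_gr_direct : (fs_gr false :&: fs_gr true = 0)%VS;
  fs_br_linear : forall (x : {ffun 'I_N -> fs_sort}) (i : 'I_N) (c : K)
      (u v : fs_sort),
    fs_br (upd x i (c *: u + v)) = c *: fs_br (upd x i u) + fs_br (upd x i v);
  fs_br_gr : forall (x : {ffun 'I_N -> fs_sort}) (p : 'I_N -> bool),
    (forall i, x i \in fs_gr (p i)) ->
    fs_br x \in fs_gr (\big[addb/false]_i p i);
  fs_br_skew : forall (x : {ffun 'I_N -> fs_sort}) (p : 'I_N -> bool)
      (i j : 'I_N),
    (forall k, x k \in fs_gr (p k)) -> j = i.+1 :> nat ->
    fs_br x = - ((-1) ^+ (p i * p j) *: fs_br (exchange i j x));
  filippov_identity : forall (i0 : 'I_N) (x : {ffun 'I_N -> fs_sort})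
      (y : {ffun 'I_N.-1 -> fs_sort}) (p : 'I_N -> bool) (r : 'I_N.-1 -> bool),
    i0 = 0%N :> nat ->
    (forall i, x i \in fs_gr (p i)) -> (forall k, y k \in fs_gr (r k)) ->
    fs_br (insert i0 (fs_br x) y) =
    \sum_(i < N) (-1) ^+ ((\sum_k r k) * (\sum_(j < N | (i < j)%N) p j))
                 *: fs_br (upd x i (fs_br (insert i0 (x i) y)))
}.

Section Filippov.
Variables (K : fieldType) (N : nat) (F : filippovSuperalgebra K N).

Definition fs_ideal (I : {vspace F}) : Prop :=
  (I = I :&: fs_gr F false + I :&: fs_gr F true)%VS /\
  (forall (i0 : 'I_N) (a : F) (y : {ffun 'I_N.-1 -> F}),
     i0 = 0%N :> nat -> a \in I -> fs_br (insert i0 a y) \in I).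

Definition fs_simple : Prop :=
  (exists x : {ffun 'I_N -> F}, fs_br x <> 0) /\
  (forall I : {vspace F}, fs_ideal I -> I = 0%VS \/ I = fullv).

(* f = ad_i(x_1, ..., x_(N-1)) for some i and some homogeneous x.  As positions
   are numbered from 0, the entries of x standing to the right of the argument
   in position i are the x k with i <= k. *)
Definition is_ad (f : 'End(F)) : Prop :=
  exists (i : 'I_N) (x : {ffun 'I_N.-1 -> F}) (p : 'I_N.-1 -> bool),
    (forall k, x k \in fs_gr F (p k)) /\
    (forall (b : bool) (a : F), a \in fs_gr F b ->
       f a = (-1) ^+ (b * (\sum_(k < N.-1 | (i <= k)%N) p k))
             *: fs_br (insert i a x)).

Definition inder (g : 'End(F)) : Prop :=
  exists (k : nat) (c : 'I_k -> K) (f : 'I_k -> 'End(F)),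
    (forall j, is_ad (f j)) /\ g = \sum_j c j *: f j.

Definition end_gr (a : bool) (f : 'End(F)) : Prop :=
  forall (b : bool) (x : F), x \in fs_gr F b -> f x \in fs_gr F (a (+) b).

End Filippov.

(** * Quotients of modules *)

Section LinearQuotient.
Variables (K : nzRingType) (M : lmodType K).

Inductive lspan (S : M -> Prop) : M -> Prop :=
  | lspan0 : lspan S 0
  | lspanD (c : K) (x y : M) : S x -> lspan S y -> lspan S (c *: x + y).

Variable S : M -> Prop.

Lemma lspan_add x y : lspan S x -> lspan S y -> lspan S (x + y).
Proof.
move=> hx hy; elim: hx => [|c a b Sa _ IH]; first by rewrite add0r.
by rewrite -addrA; apply: lspanD.
Qed.

Lemma lspan_scale c x : lspan S x -> lspan S (c *: x).
Proof.
elim=> [|d a b Sa _ IH]; first by rewrite scaler0; apply: lspan0.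
by rewrite scalerDr scalerA; apply: lspanD.
Qed.

Lemma lspan_gen x : S x -> lspan S x.
Proof.
by move=> Sx; rewrite -[x]addr0 -[x]scale1r; apply: lspanD => //; apply: lspan0.
Qed.

Definition lspanb : {pred M} := fun x => `[< lspan S x >].

Lemma lspanbP x : reflect (lspan S x) (x \in lspanb).
Proof. exact: asboolP. Qed.

Lemma lspanb_zmod_closed : zmod_closed lspanb.
Proof.
split; first by apply/lspanbP/lspan0.
move=> x y /lspanbP hx /lspanbP hy; apply/lspanbP/lspan_add => //.
by rewrite -scaleN1r; apply: lspan_scale.
Qed.

HB.instance Definition _ := GRing.isZmodClosed.Build M lspanb lspanb_zmod_closed.

(* The quotient of M by the linear span of S. *)
Definition lquot : Type := Quotient.quot lspanb.
HB.instance Definition _ := GRing.Zmodule.on lquot.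
HB.instance Definition _ := EqQuotient.on lquot.

Definition lproj (x : M) : lquot := \pi_lquot x.

Lemma lprojP x y : lproj x = lproj y <-> lspan S (x - y).
Proof.
split=> [/eqP|h]; first by rewrite -Quotient.idealrBE => /lspanbP.
by apply/eqP; rewrite -Quotient.idealrBE; apply/lspanbP.
Qed.

Lemma lprojK (x : lquot) : lproj (repr x) = x.
Proof. exact: reprK. Qed.

Lemma lprojD x y : lproj (x + y) = lproj x + lproj y.
Proof. exact: (Quotient.pi_add lspanb). Qed.

Lemma lproj_repr x : lspan S (repr (lproj x) - x).
Proof. by apply/lprojP; rewrite lprojK. Qed.

Definition lquot_scale (c : K) (x : lquot) : lquot := lproj (c *: repr x).

Lemma lproj_scale c x : lproj (c *: x) = lquot_scale c (lproj x).
Proof.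
apply/esym/lprojP; rewrite -scalerBr.
by apply: lspan_scale; apply: lproj_repr.
Qed.

Fact lquot_scaleA a b v : lquot_scale a (lquot_scale b v) = lquot_scale (a * b) v.
Proof. by rewrite -[v]lprojK -!lproj_scale scalerA. Qed.
Fact lquot_scale1 : left_id 1 lquot_scale.
Proof. by move=> v; rewrite -[v]lprojK -!lproj_scale scale1r. Qed.
Fact lquot_scaleDr : right_distributive lquot_scale +%R.
Proof.
move=> a u v; rewrite -[u]lprojK -[v]lprojK -lprojD -!lproj_scale.
by rewrite scalerDr lprojD.
Qed.
Fact lquot_scaleDl v : {morph lquot_scale^~ v : a b / a + b}.
Proof. by move=> a b; rewrite -[v]lprojK -!lproj_scale scalerDl lprojD. Qed.

HB.instance Definition _ := GRing.Zmodule_isLmodule.Build K lquot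
  lquot_scaleA lquot_scale1 lquot_scaleDr lquot_scaleDl.

Lemma lproj_is_linear : linear lproj.
Proof. by move=> c x y; rewrite lprojD lproj_scale. Qed.
HB.instance Definition _ := GRing.isLinear.Build K M lquot _ lproj lproj_is_linear.

End LinearQuotient.

Section AlgebraQuotient.
Variables (K : nzRingType) (A : lalgType K) (S : A -> Prop).

Definition sandwich (z : A) : Prop := exists a r b, S r /\ z = a * r * b.

(* The quotient of A by the two-sided ideal generated by S. *)
Definition aquot : Type := lquot sandwich.
HB.instance Definition _ := GRing.Lmodule.on aquot.

Definition aproj (x : A) : aquot := lproj sandwich x.
HB.instance Definition _ := GRing.isLinear.Build K A aquot _ aproj
  (@lproj_is_linear K A sandwich).

Lemma ideal_mull c x : lspan sandwich x -> lspan sandwich (c * x).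
Proof.
elim=> [|k _ y [a [r [b [Sr ->]]]] _ IH]; first by rewrite mulr0; apply: lspan0.
rewrite mulrDr; apply: lspan_add => //; apply: lspan_gen.
by exists (c * (k *: a)), r, b; split=> //; rewrite !scalerAl !mulrA.
Qed.

Lemma ideal_mulr c x : lspan sandwich x -> lspan sandwich (x * c).
Proof.
elim=> [|k _ y [a [r [b [Sr ->]]]] _ IH]; first by rewrite mul0r; apply: lspan0.
rewrite mulrDl; apply: lspan_add => //; apply: lspan_gen.
by exists (k *: a), r, (b * c); split=> //; rewrite !scalerAl !mulrA.
Qed.

Definition aquot_mul (x y : aquot) : aquot := aproj (repr x * repr y).

Lemma aproj_mul x y : aproj (x * y) = aquot_mul (aproj x) (aproj y).
Proof.
apply/esym/lprojP; set x' := repr _; set y' := repr _.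
rewrite -[x' * y'](subrK (x * y')) -mulrBl -addrA -mulrBr.
by apply: lspan_add; [apply: ideal_mulr | apply: ideal_mull]; apply: lproj_repr.
Qed.

Let aprojK (x : aquot) : aproj (repr x) = x := lprojK x.

Fact aquot_mulA : associative aquot_mul.
Proof.
by move=> x y z; rewrite -[x]aprojK -[y]aprojK -[z]aprojK -!aproj_mul mulrA.
Qed.
Fact aquot_mul1l : left_id (aproj 1) aquot_mul.
Proof. by move=> x; rewrite -[x]aprojK -aproj_mul mul1r. Qed.
Fact aquot_mul1r : right_id (aproj 1) aquot_mul.
Proof. by move=> x; rewrite -[x]aprojK -aproj_mul mulr1. Qed.
Fact aquot_mulDl : left_distributive aquot_mul +%R.
Proof.
move=> x y z; rewrite -[x]aprojK -[y]aprojK -[z]aprojK.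
by rewrite -raddfD -!aproj_mul mulrDl raddfD.
Qed.
Fact aquot_mulDr : right_distributive aquot_mul +%R.
Proof.
move=> x y z; rewrite -[x]aprojK -[y]aprojK -[z]aprojK.
by rewrite -raddfD -!aproj_mul mulrDr raddfD.
Qed.

HB.instance Definition _ := GRing.Zmodule_isPzRing.Build aquot
  aquot_mulA aquot_mul1l aquot_mul1r aquot_mulDl aquot_mulDr.

End AlgebraQuotient.

(** * Universal enveloping superalgebras *)

Section Enveloping.
Variables (K : fieldType) (L : lmodType K).
Variables (deg : bool -> L -> Prop) (br : L -> L -> L).

Definition free_alg : Type := {malg K[{fmonom L}]}.
HB.instance Definition _ := GRing.Lalgebra.on free_alg.

Definition letter (x : L) : free_alg := << fmu x >>.

(* T(L) is the quotient of the free algebra on the set L by the first clause;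
   the second one is xy - (-1)^(p(x)p(y)) yx = [x, y]. *)
Definition env_rel (z : free_alg) : Prop :=
  (exists (c : K) (x y : L),
     z = letter (c *: x + y) - (c *: letter x + letter y)) \/
  (exists (a b : bool) (x y : L), deg a x /\ deg b y /\
     z = letter x * letter y - (-1) ^+ (a * b) *: (letter y * letter x)
         - letter (br x y)).

Definition env : Type := aquot env_rel.
HB.instance Definition _ := GRing.Lmodule.on env.
HB.instance Definition _ := GRing.PzRing.on env.

Definition env_in (x : L) : env := aproj env_rel (letter x).

Definition env_gr (a : bool) : env -> Prop :=
  lspan (fun z => exists s : seq (bool * L),
    (forall i, (i < size s)%N ->
       deg (nth (false, 0) s i).1 (nth (false, 0) s i).2) /\
    a = \big[addb/false]_(t <- s) t.1 /\ z = \prod_(t <- s) env_in t.2).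

End Enveloping.

(** * The Lie superalgebra A(m,n) = sl(m+1,n+1) *)

Section Sl.
Variables (K : fieldType) (m n : nat).

Local Notation mat := 'M[K]_(m.+1 + n.+1).

Definition mat_gr (a : bool) (X : mat) : Prop :=
  if a then ulsubmx X = 0 /\ drsubmx X = 0
  else ursubmx X = 0 /\ dlsubmx X = 0.

Definition mat_part (a : bool) (X : mat) : mat :=
  if a then block_mx 0 (ursubmx X) (dlsubmx X) 0
  else block_mx (ulsubmx X) 0 0 (drsubmx X).

Definition supercomm (X Y : mat) : mat :=
  \sum_(a : bool) \sum_(b : bool)
    (mat_part a X *m mat_part b Y
     - (-1) ^+ (a * b) *: (mat_part b Y *m mat_part a X)).

Definition str (X : mat) : K^o := \tr (ulsubmx X) - \tr (drsubmx X).

Lemma str_is_linear : linear str.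
Proof.
move=> c X Y; rewrite /str; have -> : ulsubmx (c *: X + Y) = c *: ulsubmx X + ulsubmx Y.
  by apply/matrixP => i j; rewrite !mxE.
have -> : drsubmx (c *: X + Y) = c *: drsubmx X + drsubmx Y.
  by apply/matrixP => i j; rewrite !mxE.
by rewrite !mxtraceD !mxtraceZ opprD addrACA scalerBr.
Qed.
HB.instance Definition _ := GRing.isLinear.Build K mat K^o _ str str_is_linear.

Definition sl_space : {vspace mat} := lker (linfun str).

Lemma mem_sl X : (X \in sl_space) = (\tr (ulsubmx X) == \tr (drsubmx X)).
Proof. by rewrite memv_ker lfunE /= subr_eq0. Qed.

Lemma str_supercomm X Y : str (supercomm X Y) = 0.
Proof.
rewrite /supercomm big_bool /= !big_bool /= !linearD /= !linearN /= !linearZ /=.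
rewrite /mat_part !mulmx_block /str !block_mxKul !block_mxKdr.
rewrite !(mul0mx, mulmx0, addr0, add0r) !mxtrace0.
rewrite (mxtrace_mulC (ulsubmx Y)) (mxtrace_mulC (drsubmx Y)).
rewrite (mxtrace_mulC (ursubmx Y)) (mxtrace_mulC (dlsubmx Y)).
rewrite !(muln0, mul0n, muln1, expr0, expr1, scaleN1r, scale1r, subrr, opprK).
by rewrite !(addr0, subr0, oppr0) -[X in X + _]opprB addNr.
Qed.

Definition sl : vectType K := subvs_of sl_space.

Definition sl_gr (a : bool) (x : sl) : Prop := mat_gr a (vsval x).

(* The supercommutator lies in sl_space, so that vsproj does not change it:
   see sl_brE. *)
Definition sl_br (x y : sl) : sl := vsproj sl_space (supercomm (vsval x) (vsval y)).

Lemma sl_brE x y : vsval (sl_br x y) = supercomm (vsval x) (vsval y).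
Proof. by rewrite vsprojK // memv_ker lfunE /= str_supercomm. Qed.

Lemma mat_part_id a b (X : mat) :
  mat_gr a X -> mat_part b X = if b == a then X else 0.
Proof.
by rewrite -[X]submxK; case: a; case: b => /= -[];
  rewrite ?(block_mxKul, block_mxKur, block_mxKdl, block_mxKdr) => -> ->;
  rewrite // /block_mx ?row_mx0 ?col_mx0.
Qed.

Lemma sl_br_homog a b (x y : sl) : sl_gr a x -> sl_gr b y ->
  vsval (sl_br x y) =
    vsval x *m vsval y - (-1) ^+ (a * b) *: (vsval y *m vsval x).
Proof.
move=> hx hy; rewrite sl_brE /supercomm (bigD1 a) //= (bigD1 b) //=.
rewrite !(mat_part_id _ hx) !(mat_part_id _ hy) !eqxx.
rewrite big1 => [|c /negPf cb]; last first.
  by rewrite (mat_part_id _ hy) cb mulmx0 mul0mx scaler0 subrr.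
rewrite big1 ?addr0 // => c /negPf ca; rewrite big1 // => d _.
by rewrite (mat_part_id _ hx) ca mulmx0 mul0mx scaler0 subrr.
Qed.

Definition sl_H : {vspace mat} :=
  (sl_space :&: <<[seq delta_mx i i | i <- enum 'I_(m.+1 + n.+1)]>>)%VS.

Definition sl_Np : {vspace mat} :=
  (<<[seq delta_mx k l
       | k <- enum 'I_(m.+1 + n.+1),
         l <- [seq l : 'I_(m.+1 + n.+1) <- enum 'I_(m.+1 + n.+1)
                | (k < l)%N]]>>)%VS.

End Sl.

(** * Highest weight modules over A(m,n) *)

Section HighestWeight.
Variables (K : fieldType) (m n : nat).

Local Notation G := (sl K m n).

Definition envG : Type := env (@sl_gr K m n) (@sl_br K m n).
HB.instance Definition _ := GRing.Lmodule.on envG.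
HB.instance Definition _ := GRing.PzRing.on envG.

Definition inG (x : G) : envG := env_in (@sl_gr K m n) (@sl_br K m n) x.

Section Induced.
Variable Lam : {linear subvs_of (sl_H K m n) -> K^o}.

(* As <v> is a line, U(G) (x)_K <v> is U(G), with u (x) v written u.  The
   tensor product over U(B) identifies ub (x) v with u (x) bv; it suffices to
   do so for b in B, as B generates U(B).  If b = h + e with h in H and e in
   N^+, then bv = Lam(h)v. *)
Definition ind_rel (z : envG) : Prop :=
  exists (u : envG) (b : G) (h : subvs_of (sl_H K m n)) (e : 'M[K]_(m.+1 + n.+1)),
    e \in sl_Np K m n /\ vsval b = vsval h + e /\
    z = u * inG b - Lam h *: u.

Definition ind : Type := lquot ind_rel.
HB.instance Definition _ := GRing.Lmodule.on ind.

Definition ind_act (g : G) (x : ind) : ind := lproj ind_rel (inG g * repr x).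

(* eps is the parity given to 1 (x) v. *)
Definition ind_gr (eps a : bool) (x : ind) : Prop :=
  exists u : envG,
    env_gr (deg := @sl_gr K m n) (br := @sl_br K m n) (a (+) eps) u /\
    x = lproj ind_rel u.

(* Graded submodules; the two values of eps give the same decompositions. *)
Definition ind_submodule (I : ind -> Prop) : Prop :=
  [/\ I 0,
      forall (c : K) (x y : ind), I x -> I y -> I (c *: x + y),
      forall (g : G) (x : ind), I x -> I (ind_act g x) &
      forall x : ind, I x -> exists x0 x1 : ind,
        [/\ ind_gr false false x0, ind_gr false true x1, I x0, I x1
          & x = x0 + x1]].

Definition ind_maximal (I : ind -> Prop) : Prop :=
  [/\ ind_submodule I, exists x, ~ I x &
      forall J : ind -> Prop, ind_submodule J -> (exists x, ~ J x) ->
        (forall x, I x -> J x) -> forall x, J x -> I x].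

Definition ind_unique_maximal (I : ind -> Prop) : Prop :=
  ind_maximal I /\ forall J, ind_maximal J -> forall x, J x <-> I x.

Section Simple.
Variable I : ind -> Prop.

Definition hw : Type := lquot I.
HB.instance Definition _ := GRing.Lmodule.on hw.

Definition hw_act (g : G) (x : hw) : hw := lproj I (ind_act g (repr x)).

Definition hw_gr (eps a : bool) (x : hw) : Prop :=
  exists y : ind, ind_gr eps a y /\ x = lproj I y.

End Simple.
End Induced.

Section TypeA.
Variables (N : nat) (F : filippovSuperalgebra K N).

(* phi is an isomorphism of Lie superalgebras from A(m,n) onto Inder(F). *)
Definition type_iso (phi : {linear G -> 'End(F)}) : Prop :=
  [/\ injective phi,
      forall g : 'End(F), inder g <-> exists x : G, g = phi x,
      forall (a : bool) (x : G), sl_gr a x -> end_gr a (phi x) &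
      forall (a b : bool) (x y : G), sl_gr a x -> sl_gr b y ->
        phi (sl_br x y) =
          (phi x \o phi y)%VF - (-1) ^+ (a * b) *: (phi y \o phi x)%VF].

(* F, regarded as an A(m,n)-module via phi, is isomorphic to V_Lam for some
   Lam and some choice of the parity of the highest weight vector. *)
Definition highest_weight_module (phi : {linear G -> 'End(F)}) : Prop :=
  exists (Lam : {linear subvs_of (sl_H K m n) -> K^o}) (eps : bool)
         (I : ind Lam -> Prop) (f : {linear hw I -> F}),
    [/\ ind_unique_maximal I,
        bijective f,
        forall (g : G) (x : hw I), f (hw_act g x) = phi g (f x) &
        forall (a : bool) (x : hw I), hw_gr eps a x -> f x \in fs_gr F a].

End TypeA.
End HighestWeight.

(* Main.v *)
From HB Require Import structures.
Require Import Defs.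
From mathcomp Require Import all_boot all_order all_algebra perm zify ring.
From mathcomp Require Import boolp.

Set Implicit Arguments.
Unset Strict Implicit.
Unset Printing Implicit Defensive.

Import GRing.Theory Order.TTheory Num.Theory.
Local Open Scope ring_scope.

(** Write e_st for the action on F of the matrix unit with entry (s, t).  Give
    the index s the parity of its block, so that e_st has parity
    par s + par t.  The proof plays two facts against each other.  First, if
    u_1, ..., u_(N-1) are weight vectors, the operator
    a |-> [a, u_1, ..., u_(N-1)] is, up to a sign on odd a, given by a matrix
    whose weight is the sum of the weights of the u_i
    ([weight_args_matrix]); this sum is therefore very small.  Secondly, a and
    any u_i may be exchanged, up to sign.

    As m <> n, there are two indices p <> q of the same parity.  Put e = e_pq,
    f = e_qp and h = [e, f].  The space F has a basis of homogeneous weight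
    vectors ([weight_vec_span]), on which h has integer eigenvalues
    ([int_weight]); let k be the largest one and let x0 <> 0 be a weight
    vector with h x0 = k x0.

    - Some tuple with u_1 = x0 gives a nonzero multiple of e
      ([exists_realizing]).  To see it, take a tuple with u_1 = x0 giving a
      nonzero operator.  A root vector of positive h-weight kills x0, hence
      its commutator with the operator only changes the other arguments.  One can
      go on raising until the matrix commutes with the root vectors e_pj and
      e_jq; only the multiples of e do so ([centraliser]), because the
      supertrace m - n of the identity is not 0.
    - x0 is even ([top_even]).  If it were odd, take such a tuple with as many
      entries x0 as possible, say d of them, and apply the derivation f to
      [x0, u_1, ..., u_(N-1)] = c e x0 = 0.  The slot of the operator and each
      of the d arguments x0 contribute c k x0, the other arguments contribute
      0 by maximality of d; so (d + 1) k = 0.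
    - k = 1 ([top_is_one]).  The weights of the u_i add up to 2 and are at most
      k, so k > 0 and e f x0 <> 0.  Exchanging f x0 with u_i shows that the
      weight of u_i is at least k - 2.  With N >= 3 there is an argument
      besides u_1 = x0, and this leaves k = 1, or k = 2 with a vector u_i of
      weight 0 such that e u_i <> 0; parity excludes the latter.

    Exchanging p and q as well, h has eigenvalue 0 on every odd weight vector,
    for every such pair (p, q) ([odd_zero]).

    If each parity is that of at least two indices, then for odd y, indices
    a <> b of one parity and j <> k of the other, the products
    e_ja e_aj y, e_jb e_bj y and e_kb e_bk y coincide, while e_bj sends the
    first to e_bj y and the last to - e_bj y.  So odd elements of the algebra
    kill y; they generate the algebra, and y = 0 by simplicity
    ([odd_vec_eq0]).

    If j is the only index of its parity, the vectors of h-weight 1 form a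
    line ([singleton_class]).  But the weights of the arguments giving e are
    at most 1 and add up to 2, so two arguments lie on that line; they are
    even, and the bracket is alternating in even arguments. *)

(** * Exchanging arguments of the bracket *)

Lemma odd_sum_addb (I : finType) (P : pred I) (p : I -> bool) :
  odd (\sum_(i | P i) p i) = \big[addb/false]_(i | P i) p i.
Proof.
by rewrite (big_morph odd oddD (erefl (odd 0))); apply: eq_bigr => i _; case: (p i).
Qed.

Section Bracket.
Variables (K : fieldType) (N : nat) (F : filippovSuperalgebra K N.+1).
Implicit Types (x : {ffun 'I_N.+1 -> F}) (p : 'I_N.+1 -> bool) (a b : bool).

Definition homog_args x p := forall i, x i \in fs_gr F (p i).

Lemma upd_same x i u : upd x i u i = u. Proof. by rewrite ffunE eqxx. Qed.
Lemma upd_other x i j u : j != i -> upd x i u j = x j.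
Proof. by move=> ji; rewrite ffunE (negPf ji). Qed.
Lemma upd_id x i : upd x i (x i) = x.
Proof. by apply/ffunP => j; rewrite ffunE; case: eqP => // ->. Qed.
Lemma upd_upd x i u v : upd (upd x i u) i v = upd x i v.
Proof. by apply/ffunP => j; rewrite !ffunE; case: eqP. Qed.
Lemma updC x i j u v : i != j -> upd (upd x i u) j v = upd (upd x j v) i u.
Proof.
move=> ij; apply/ffunP => k; rewrite !ffunE.
by case: (eqVneq k j) => // ->; rewrite eq_sym (negPf ij).
Qed.
Lemma exchange_upd x i j u v : i != j ->
  exchange i j (upd (upd x i u) j v) = upd (upd x i v) j u.
Proof.
move=> ij; apply/ffunP => k; rewrite !ffunE.
case: (tpermP i j k) => [->|->|/eqP ki /eqP kj].
- by rewrite !eqxx (negPf ij).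
- by rewrite !eqxx (negPf ij).
- by rewrite (negPf ki) (negPf kj).
Qed.

Definition slot x i (u : F) : F := fs_br (upd x i u).
Fact slot_is_linear x i : linear (slot x i).
Proof. by move=> c u v; rewrite /slot fs_br_linear. Qed.
HB.instance Definition _ x i :=
  GRing.isLinear.Build K F F _ (slot x i) (slot_is_linear x i).

Lemma br_updZ x i c u : fs_br (upd x i (c *: u)) = c *: fs_br (upd x i u).
Proof. exact: (linearZ_LR (slot x i)). Qed.

Lemma br_exchange_next x p (i j : 'I_N.+1) : homog_args x p -> j = i.+1 :> nat ->
  fs_br (exchange i j x) = (-1) ^+ (~~ (p i && p j)) *: fs_br x.
Proof.
move=> hx e; rewrite [fs_br x](fs_br_skew hx e) scalerN scalerA -scaleNr.
by case: (p i); case: (p j);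
  rewrite /= ?(expr0, expr1, mulr1, mul1r, mulN1r, opprK, scale1r).
Qed.

(** The transposition (i j) is the product (k j)(i k)(k j) with k = j - 1, which
    reduces it to adjacent ones.  The sign depends on all the entries between
    positions i and j, unless the two exchanged entries have the same parity p;
    then it is - (-1)^p. *)
Lemma br_exchange x p (i j : 'I_N.+1) : homog_args x p -> i != j ->
  exists2 s : bool, fs_br (exchange i j x) = (-1) ^+ s *: fs_br x
    & (p i = p j -> s = ~~ p i).
Proof.
wlog lt_ij : i j / (i < j)%N => [H|].
  move=> hx ij; case: (ltngtP i j) => [l|l|/val_inj e]; first exact: H.
    have [s e1 e2] := H _ _ l hx (introN eqP (fun e => elimN eqP ij (esym e))).
    exists s => [|/esym e3]; first by rewrite -e1 /exchange tpermC.
    by rewrite (e2 e3) e3.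
  by rewrite e eqxx in ij.
have [d dE] : exists d, (j = i + d.+1 :> nat)%N.
  by exists (j - i.+1)%N; rewrite addnS -addSn subnKC.
elim: d i j lt_ij x p dE => [|d IH] i j lt_ij x p dE hx ij.
  exists (~~ (p i && p j)); last by move=> ->; rewrite andbb.
  by apply: br_exchange_next => //; rewrite dE addn1.
have lj' : (i + d.+1 < N.+1)%N by apply: leq_ltn_trans (ltn_ord j); rewrite dE !addnS leqnSn.
pose k := Ordinal lj'.
have ik : i != k by rewrite -val_eqE /= -{1}[val i]addn0 eqn_add2l.
have kj : k != j by rewrite -val_eqE /= dE eqn_add2l eqn_leq ltnn andbF.
have ki : k != i by rewrite eq_sym. have jk : j != k by rewrite eq_sym.
have ji : j != i by rewrite eq_sym.
have ekj : j = k.+1 :> nat by rewrite dE addnS.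
pose y := exchange k j x; pose p' := fun l => p (tperm k j l).
have hy : homog_args y p' by move=> l; rewrite ffunE; apply: hx.
have lik : (i < k)%N by rewrite /= addnS ltnS leq_addr.
have [s e1 e2] := IH i k lik y p' (erefl _) hy ik.
pose z := exchange i k y; pose p'' := fun l => p' (tperm i k l).
have hz : homog_args z p'' by move=> l; rewrite ffunE; apply: hy.
have -> : exchange i j x = exchange k j z.
  apply/ffunP => l; rewrite !ffunE; congr (x _).
  have [->|li] := eqVneq l i.
    by rewrite (tpermD ki ji) !tpermL.
  have [->|lj] := eqVneq l j.
    by rewrite !tpermR (tpermD ki ji).
  have [->|lk] := eqVneq l k.
    by rewrite (tpermD ik jk) tpermL (tpermD ij kj) tpermR.
  by rewrite !tpermD 1?eq_sym.
rewrite (br_exchange_next hz ekj) e1 (br_exchange_next hx ekj) !scalerA -!signr_addb.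
have p'i : p' i = p i by rewrite /p' tpermD.
have p'k : p' k = p j by rewrite /p' tpermL.
have p''k : p'' k = p i by rewrite /p'' tpermR.
have p''j : p'' j = p k by rewrite /p'' tpermD // /p' tpermR.
exists (~~ (p'' k && p'' j) (+) s (+) ~~ (p k && p j)); first by rewrite ?addbA.
move: e2; rewrite p''k p''j p'i p'k => e2 pij; rewrite (e2 pij) pij.
by case: (p j); case: (p k).
Qed.

End Bracket.

(** * Inner derivations *)

Section Grading.
Variables (K : fieldType) (N : nat) (F : filippovSuperalgebra K N).

Lemma gr_decomp (a : F) : exists a0 a1,
  [/\ a0 \in fs_gr F false, a1 \in fs_gr F true & a = a0 + a1].
Proof.
have: a \in (fs_gr F false + fs_gr F true)%VS by rewrite fs_gr_sum memvf.
by case/memv_addP=> a0 h0 [a1 h1 ->]; exists a0, a1.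
Qed.

Lemma gr_two_parities b (a : F) : a \in fs_gr F b -> a \in fs_gr F (~~ b) -> a = 0.
Proof.
move=> h1 h2; apply/eqP; rewrite -memv0 -(fs_gr_direct F) memv_cap.
by case: b h1 h2 => /= -> ->.
Qed.

Lemma eq_on_homog (f g : F -> F) : (forall u v, f (u + v) = f u + f v) ->
  (forall u v, g (u + v) = g u + g v) ->
  (forall b a, a \in fs_gr F b -> f a = g a) -> f =1 g.
Proof.
move=> hf hg fg a; have [a0 [a1 [h0 h1 ->]]] := gr_decomp a.
by rewrite hf hg (fg _ _ h0) (fg _ _ h1).
Qed.

Lemma end_gr_two_parities b (f : 'End(F)) : end_gr b f -> end_gr (~~ b) f -> f = 0.
Proof.
move=> h1 h2; apply/lfunP => a; rewrite lfunE /=.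
move: a; apply: eq_on_homog => [u v|u v|c a ha]; rewrite ?linearD ?addr0 //.
by apply: gr_two_parities (h1 _ _ ha) _; rewrite -addNb; apply: h2.
Qed.

Lemma end_gr_lin b c (f g : 'End(F)) :
  end_gr b f -> end_gr b g -> end_gr b (c *: f + g).
Proof.
by move=> hf hg d a ha; rewrite !lfunE /= memvD ?memvZ ?hf ?hg // lfunE /= memvZ ?hf.
Qed.

Lemma end_gr_sum b (I : finType) (P : pred I) (c : I -> K) (f : I -> 'End(F)) :
  (forall i, P i -> end_gr b (f i)) -> end_gr b (\sum_(i | P i) c i *: f i).
Proof.
move=> hf; elim/big_rec: _ => [d a ha|i g Pi]; first by rewrite lfunE mem0v.
by apply: end_gr_lin; apply: hf.
Qed.

(** The parity involution, which turns the right operators of the Filippov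
    identity into left operators. *)
Definition par_inv : 'End(F) :=
  (daddv_pi (fs_gr F false) (fs_gr F true) - daddv_pi (fs_gr F true) (fs_gr F false))%R.

Lemma par_invE b (a : F) : a \in fs_gr F b -> par_inv a = (-1) ^+ b *: a.
Proof.
have d01 := fs_gr_direct F; have d10 : (fs_gr F true :&: fs_gr F false = 0)%VS.
  by rewrite capvC.
have z U V (w : F) : (U :&: V = 0)%VS -> w \in V -> daddv_pi U V w = 0.
  move=> d wV; have dV : (V :&: U = 0)%VS by rewrite capvC.
  have := daddv_pi_add d (w := w); rewrite (daddv_pi_id dV wV).
  move=> /(_ (subvP (addvSr U V) _ wV)).
  by rewrite -[RHS]add0r => /addIr.
case: b => ha; rewrite !lfunE /= lfunE /=.
  by rewrite (daddv_pi_id d10 ha) (z _ _ _ d01 ha) sub0r scaleN1r.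
by rewrite (daddv_pi_id d01 ha) (z _ _ _ d10 ha) subr0 scale1r.
Qed.

End Grading.

Section Operators.
Variables (K : fieldType) (N : nat) (F : filippovSuperalgebra K N.+1).
Implicit Types (x : {ffun 'I_N.+1 -> F}) (p : 'I_N.+1 -> bool) (a : F) (b : bool).

Lemma insert_at T (i : 'I_N.+1) (a : T) (y : {ffun 'I_N -> T}) :
  insert (N := N.+1) i a y i = a.
Proof. by rewrite ffunE unlift_none. Qed.

Lemma insert_lift T (i : 'I_N.+1) (a : T) (y : {ffun 'I_N -> T}) k :
  insert (N := N.+1) i a y (lift i k) = y k.
Proof. by rewrite ffunE liftK. Qed.

Lemma insert_next T (i j : 'I_N.+1) (a : T) (y : {ffun 'I_N -> T}) :
  j = i.+1 :> nat ->
  insert (N := N.+1) j a y = exchange i j (insert (N := N.+1) i a y).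
Proof.
move=> ij; apply/ffunP => l; rewrite [RHS]ffunE.
case: (unliftP j l) => [k|] ->; last by rewrite tpermR !insert_at.
rewrite insert_lift; suff -> : tperm i j (lift j k) = lift i k by rewrite insert_lift.
apply: val_inj; case: tpermP => [/(congr1 val)|/(congr1 val)|/eqP + /eqP].
all: rewrite -?val_eqE /= /bump ij; lia.
Qed.

Lemma br_insert (i : 'I_N.+1) b (a : F) (y : {ffun 'I_N -> F}) (r : 'I_N -> bool) :
  a \in fs_gr F b -> (forall k, y k \in fs_gr F (r k)) ->
  fs_br (insert (N := N.+1) i a y) =
  (-1) ^+ (odd i (+) (b && \big[addb/false]_(k < N | (k < i)%N) r k))
    *: fs_br (insert (N := N.+1) ord0 a y).
Proof.
move=> ha hy.
case: i => i; elim: i => [|i IH] lti.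
  rewrite big1 //= andbF scale1r; congr (fs_br (insert _ _ _)); exact: val_inj.
have lti' : (i < N.+1)%N by apply: ltnW.
pose i' := Ordinal lti'; pose p := fun j => if unlift i' j is Some k then r k else b.
have hp : homog_args (insert (N := N.+1) i' a y) p.
  by move=> j; rewrite ffunE /p; case: (unlift i' j).
rewrite (@insert_next _ i') // (br_exchange_next hp) // IH scalerA -signr_addb.
have ltiN : (i < N)%N by [].
pose k0 := Ordinal ltiN.
have -> : p i' = b by rewrite /p unlift_none.
have -> : p (Ordinal lti) = r k0.
  rewrite /p; have -> : Ordinal lti = lift i' k0.
    by apply: val_inj; rewrite /= /bump leqnn.
  by rewrite liftK.
rewrite [in RHS](bigD1 k0) //=.
rewrite [in RHS](eq_bigl (fun k : 'I_N => (k < i)%N)); last first.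
  by move=> k; rewrite -val_eqE /=; lia.
by congr (_ ^+ (nat_of_bool _) *: _); case: (odd i) (b) (r k0) (\big[addb/false]_(_ | _) _) => [] [] [] [].
Qed.

(** The derivation rule for an operator f written on the left: f passes the
    entries that precede its argument. *)
Definition superder b (f : F -> F) := forall x p, homog_args x p ->
  f (fs_br x) = \sum_(i < N.+1) (-1) ^+ (b && \big[addb/false]_(j < N.+1 | (j < i)%N) p j)
                  *: fs_br (upd x i (f (x i))).

Lemma parity_split p (i : 'I_N.+1) :
  \big[addb/false]_j p j = \big[addb/false]_(j < N.+1 | (j < i)%N) p j (+) p i
     (+) \big[addb/false]_(j < N.+1 | (i < j)%N) p j.
Proof.
rewrite (bigID (fun j : 'I_N.+1 => (j <= i)%N)) /= (bigD1 i) //=.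
rewrite (eq_bigl (fun j : 'I_N.+1 => (j < i)%N)); last first.
  by move=> k; rewrite -val_eqE /= ltn_neqAle andbC.
rewrite [X in _ (+) X](eq_bigl (fun j : 'I_N.+1 => (i < j)%N)); last first.
  by move=> k; rewrite -ltnNge.
by rewrite (addbC (p i)).
Qed.

Lemma sgn_odd n : (-1 : K) ^+ n = (-1) ^+ odd n. Proof. by rewrite signr_odd. Qed.

(** Moving the argument to the first position shows that all the ad_i are, up to
    a global sign, the same operator. *)
Lemma is_adE (f : 'End(F)) : is_ad f ->
  exists (e : bool) (y : {ffun 'I_N -> F}) (r : 'I_N -> bool),
    (forall k, y k \in fs_gr F (r k)) /\
    (forall b a, a \in fs_gr F b -> f a =
       (-1) ^+ (e (+) (b && \big[addb/false]_k r k))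
         *: fs_br (insert (N := N.+1) ord0 a y)).
Proof.
case=> i [y [r [hy hf]]]; exists (odd i), y, r; split=> // b a ha.
rewrite (hf _ _ ha) (br_insert i ha hy) scalerA sgn_odd -signr_addb.
rewrite oddM oddb.
have -> : odd (\sum_(k < N.+1.-1 | (i <= k)%N) r k) =
          \big[addb/false]_(k < N | ~~ (k < i)%N) r k.
  by rewrite odd_sum_addb; apply: eq_bigl => k; rewrite -leqNgt.
rewrite [in RHS](bigID (fun k : 'I_N => (k < i)%N)) /=.
congr (_ ^+ (nat_of_bool _) *: _).
by move: (odd i) (\big[addb/false]_(_ | _) _) (\big[addb/false]_(_ | _) _); case: (b) => [] [] [] [].
Qed.

(** The Filippov identity, with the signs of operators acting on the right
    transported to the left. *)
Lemma is_ad_superder (f : 'End(F)) : is_ad f -> exists b, end_gr b f /\ superder b f.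
Proof.
move=> /is_adE [e [y [r [hy hf]]]]; set P := \big[addb/false]_k r k in hf.
exists P; split=> [b a ha|x p hx].
  rewrite (hf _ _ ha) memvZ //.
  pose p i := if unlift ord0 i is Some k then r k else b.
  have hp : homog_args (insert (N := N.+1) ord0 a y) p.
    by move=> j; rewrite ffunE /p; case: (unlift ord0 j).
  suff -> : P (+) b = \big[addb/false]_i p i by apply: fs_br_gr.
  rewrite big_ord_recl {1}/p unlift_none addbC; congr addb.
  by apply: eq_bigr => k _; rewrite /p liftK.
rewrite (hf _ _ (fs_br_gr hx)) (filippov_identity (i0 := ord0) _ hx hy) //.
rewrite scaler_sumr; apply: eq_bigr => i _.
have -> : fs_br (insert (N := N.+1) ord0 (x i) y) = (-1) ^+ (e (+) (p i && P)) *: f (x i).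
  by rewrite (hf _ _ (hx i)) scalerA -signr_addb addbb scale1r.
rewrite br_updZ !scalerA; congr (_ *: _).
rewrite [X in _ * X * _]sgn_odd oddM !odd_sum_addb -/P -!signr_addb.
rewrite (parity_split p i).
congr (_ ^+ nat_of_bool _).
move: (\big[addb/false]_(_ | _) _) (\big[addb/false]_(_ | _) _) (p i) (e) (P).
by do 5!case.
Qed.

Lemma superder_sum b (I : finType) (P : pred I) (c : I -> K) (f : I -> 'End(F)) :
  (forall i, P i -> superder b (f i)) -> superder b (\sum_(i | P i) c i *: f i : 'End(F)).
Proof.
move=> hf x p hx; rewrite sum_lfunE.
rewrite (eq_bigr (fun i => c i *: \sum_(j < N.+1) (-1) ^+ (b && \big[addb/false]_(k < N.+1 | (k < j)%N) p k)
                  *: fs_br (upd x j (f i (x j))))); last first.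
  by move=> i Pi; rewrite lfunE /= (hf i Pi _ _ hx).
under eq_bigr do rewrite scaler_sumr.
rewrite exchange_big; apply: eq_bigr => j _ /=.
rewrite -/(slot x j _) sum_lfunE linear_sum /= scaler_sumr; apply: eq_bigr => i _.
by rewrite lfunE /= /slot br_updZ !scalerA mulrC.
Qed.

(** A combination of operators ad_i which is homogeneous of parity b only
    involves those of parity b: the others add up to an operator having both
    parities, hence to 0. *)
Lemma inder_superder b (g : 'End(F)) : inder g -> end_gr b g -> superder b g.
Proof.
case=> k [c [f [hf ->]]] hg.
have /fin_all_exists [d hd] i := is_ad_superder (hf i).
have e : \sum_j c j *: f j = \sum_(j | d j == b) c j *: f j.
  rewrite (bigID (fun j => d j == b)) /=.
  suff -> : \sum_(j | d j != b) c j *: f j = 0 by rewrite addr0.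
  apply: (@end_gr_two_parities _ _ _ b).
    have -> : \sum_(j | d j != b) c j *: f j =
              (-1) *: \sum_(j | d j == b) c j *: f j + \sum_j c j *: f j.
      by rewrite [X in _ = _ + X](bigID (fun j => d j == b)) /= scaleN1r addKr.
    apply: end_gr_lin => //; apply: end_gr_sum => i /eqP <-; exact: (hd i).1.
  apply: end_gr_sum => i; have := (hd i).1.
  by case: (d i) b {hg} => [] [].
by rewrite e; apply: superder_sum => i /eqP <-; exact: (hd i).2.
Qed.

(** The operator ad of the entries of x other than the one in position 0, when
    the sum of their parities is b. *)
Definition left_op x b : 'End(F) :=
  (linfun (slot x ord0) \o (if b then par_inv F else \1))%VF.

Lemma left_opE x b c a : a \in fs_gr F c ->
  left_op x b a = (-1) ^+ (b && c) *: slot x ord0 a.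
Proof.
move=> ha; rewrite lfunE /=; case: b; rewrite /= ?(par_invE ha) ?id_lfunE lfunE /=.
  by rewrite linearZ.
by rewrite scale1r.
Qed.

Lemma is_ad_left_op x p : (forall i, i != ord0 -> x i \in fs_gr F (p i)) ->
  is_ad (left_op x (\big[addb/false]_(i | i != ord0) p i)).
Proof.
move=> hx; exists ord0, [ffun k => x (lift ord0 k)], (fun k => p (lift ord0 k)).
split=> [k|b a ha]; first by rewrite ffunE hx // eq_sym neq_lift.
rewrite (left_opE _ _ ha) [in RHS]sgn_odd oddM odd_sum_addb; congr (_ ^+ nat_of_bool _ *: fs_br _).
  by rewrite big_mkcond big_ord_recl /= andbC; case: (b).
apply/ffunP => j; rewrite !ffunE; case: (unliftP ord0 j) => [k|] ->; last by rewrite eqxx.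
by rewrite ffunE eq_sym (negPf (neq_lift _ _)).
Qed.

Lemma inder_left_op x p : (forall i, i != ord0 -> x i \in fs_gr F (p i)) ->
  inder (left_op x (\big[addb/false]_(i | i != ord0) p i)).
Proof.
move=> hx; exists 1%N, (fun _ => 1), (fun _ => left_op x (\big[addb/false]_(i | i != ord0) p i)).
by split=> [_|]; [exact: is_ad_left_op | rewrite big_ord1 scale1r].
Qed.

Lemma left_op_gr x p : (forall i, i != ord0 -> x i \in fs_gr F (p i)) ->
  end_gr (\big[addb/false]_(i | i != ord0) p i) (left_op x (\big[addb/false]_(i | i != ord0) p i)).
Proof.
move=> hx b a ha; rewrite (left_opE _ _ ha) memvZ //.
pose p' i := if i == ord0 then b else p i.
have h : homog_args (upd x ord0 a) p'.
  by move=> i; rewrite ffunE /p'; case: eqP => // /eqP /hx.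
suff -> : \big[addb/false]_(i | i != ord0) p i (+) b = \big[addb/false]_i p' i.
  exact: fs_br_gr h.
rewrite [RHS](bigD1 ord0) //= {1}/p' eqxx addbC; congr addb.
by apply: eq_bigr => i /negPf i0; rewrite /p' i0.
Qed.

(** The bracket being multilinear, the arguments outside A may be taken in any
    family that spans F. *)
Lemma br_span (S : seq F) (A : {set 'I_N.+1}) (W : {vspace F}) x :
  <<S>>%VS = fullv ->
  (forall z : {ffun 'I_N.+1 -> F}, (forall i, i \in A -> z i = x i) ->
     (forall i, i \notin A -> z i \in S) -> fs_br z \in W) ->
  fs_br x \in W.
Proof.
move=> fS; have [n] := ubnP #|[set i | (i \notin A) && (x i \notin S)]|.
elim: n x => // n IH x ltn H.
have [/forallP h|/forallPn [i]] := boolP [forall i, (i \notin A) ==> (x i \in S)].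
  by apply: H => // i iA; apply: (implyP (h i)).
rewrite negb_imply => /andP [iA xiS].
have xi : x i \in <<in_tuple S>>%VS by rewrite fS memvf.
rewrite -[x](upd_id x i) -/(slot x i (x i)) (coord_span xi) linear_sum memv_suml // => j _.
rewrite linearZ /= memvZ // /slot IH //.
  rewrite ltnS in ltn; apply: leq_trans ltn; apply: proper_card; apply/properP; split.
    apply/subsetP => k; rewrite !inE => /andP [kA]; rewrite kA.
    have [->|ki] := eqVneq k i; last by rewrite upd_other.
    by rewrite upd_same mem_nth.
  by exists i; rewrite !inE ?iA //= upd_same mem_nth.
move=> z hz1 hz2; apply: H => // k kA; rewrite hz1 // upd_other //.
by apply: contraNneq iA => <-.
Qed.

Lemma homog_span : exists2 S : seq F, <<S>>%VS = fullv &
  forall w, w \in S -> exists b, w \in fs_gr F b.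
Proof.
exists (vbasis (fs_gr F false) ++ vbasis (fs_gr F true)).
  by rewrite span_cat !(span_basis (vbasisP _)) fs_gr_sum.
move=> w; rewrite mem_cat => /orP [] /vbasis_mem hw; by [exists false | exists true].
Qed.

Lemma inder_br (W : {vspace F}) (a : F) b : a \in fs_gr F b ->
  (forall g, inder g -> g a \in W) ->
  forall x, fs_br (upd x ord0 a) \in W.
Proof.
move=> ha hg x; have [S fS hS] := homog_span.
apply: (br_span (S := S) (A := [set ord0])) => // z hz1 hz2.
have /fin_all_exists [p hp] (i : 'I_N.+1) : exists c, i != ord0 -> z i \in fs_gr F c.
  case: (eqVneq i ord0) => [->|i0]; first by exists false.
  by have [|c hc] := hS (z i); [apply: hz2; rewrite inE | exists c].
have -> : z = upd z ord0 a.
  by rewrite -{1}[z](upd_id z ord0) hz1 ?inE // upd_same.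
have := hg _ (inder_left_op hp); rewrite (left_opE _ _ ha) /slot.
by rewrite -signr_odd; case: odd; rewrite ?scaleN1r ?memvN ?scale1r.
Qed.

Lemma insert_upd (c : F) (y : {ffun 'I_N -> F}) (i0 : 'I_N.+1) : i0 = 0%N :> nat ->
  insert (N := N.+1) i0 c y = upd (insert (N := N.+1) ord0 0 y) ord0 c.
Proof.
move=> i00; have -> : i0 = ord0 by apply: val_inj.
apply/ffunP => j; rewrite !ffunE.
by case: (unliftP ord0 j) => [k|] ->; rewrite ?eqxx // eq_sym (negPf (neq_lift _ _)).
Qed.

(** Ideals are stable under the brackets with arbitrary arguments; it suffices
    to consider Inder(F), since a bracket with homogeneous arguments is such an
    operator and these arguments span F. *)
Lemma span_ideal (S : seq F) : (forall s, s \in S -> exists b, s \in fs_gr F b) ->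
  (forall g, inder g -> forall s, s \in S -> g s \in <<S>>%VS) -> fs_ideal <<S>>%VS.
Proof.
move=> hS hg; split=> [|i0 a y e0 ha].
  apply/eqP; rewrite eqEsubv; apply/andP; split; last by rewrite subv_add !capvSl.
  apply/span_subvP => s hs; have [b hb] := hS s hs.
  have : s \in (<<S>> :&: fs_gr F b)%VS by rewrite memv_cap memv_span.
  by case: (b); apply: subvP; [exact: addvSr | exact: addvSl].
rewrite insert_upd // -/(slot _ ord0 a).
have as' : a \in <<in_tuple S>>%VS by [].
rewrite (coord_span as') linear_sum memv_suml // => j _; rewrite linearZ memvZ //=.
have sj : (in_tuple S)`_j \in S by rewrite mem_nth.
have [b hb] := hS _ sj; apply: inder_br hb _ _ => g /hg; exact.
Qed.

(** The line spanned by such a vector is an ideal, and it is not F, since then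
    all brackets would vanish. *)
Lemma simple_ann (a : F) b : fs_simple F -> a \in fs_gr F b ->
  (forall g, inder g -> g a = 0) -> a = 0.
Proof.
move=> [[x hx] H] ha h0.
case: (H <<[:: a]>>%VS).
- apply: span_ideal => [s|g hg s]; rewrite inE => /eqP ->; first by exists b.
  by rewrite h0 // mem0v.
- by move=> a0; apply/eqP; rewrite -memv0 -a0 memv_span // inE.
- rewrite span_seq1 => af; case: hx; have /vlineP [k xk] : x ord0 \in <[a]>%VS by rewrite af memvf.
  rewrite -[x](upd_id x ord0) xk br_updZ; apply/eqP; rewrite -memv0 memvZ //.
  by apply: inder_br ha _ _ => g /h0 ->; rewrite mem0v.
Qed.

End Operators.

(** * Eigenvectors *)

Section Eigen.
Variables (K : closedFieldType) (V : vectType K).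
Implicit Types (f g : 'End(V)) (U : {vspace V}).

Lemma eigen_exists f U : U != 0%VS -> (f @: U <= U)%VS ->
  exists c w, [/\ w \in U, w != 0 & f w = c *: w].
Proof.
move=> U0 fU; pose n := \dim U.
have n0 : (0 < n)%N by rewrite lt0n dimv_eq0.
pose A : 'M[K]_n := \matrix_(i, j) coord (vbasis U) j (f (vbasis U)`_i).
have fA (i : 'I_n) : f (vbasis U)`_i = \sum_j A i j *: (vbasis U)`_j.
  under eq_bigr do rewrite mxE; apply: coord_vbasis.
  by apply: (subvP fU); apply: memv_img; apply: vbasis_mem; rewrite mem_nth ?size_tuple.
have /closed_rootP [c] : size (char_poly A) != 1%N by rewrite size_char_poly; case: n n0 {A fA}.
rewrite -eigenvalue_root_char => /eigenvalueP [v vA v0].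
exists c, (\sum_i v 0 i *: (vbasis U)`_i); split.
- by apply: memv_suml => i _; rewrite memvZ // vbasis_mem // mem_nth ?size_tuple.
- apply: contraNneq v0 => s0; apply/eqP/rowP => i; rewrite mxE.
  have := basis_free (vbasisP U) => /freeP; exact.
- rewrite linear_sum scaler_sumr /=.
  under eq_bigr do rewrite linearZ /= fA scaler_sumr.
  rewrite exchange_big; apply: eq_bigr => j _ /=.
  transitivity ((v *m A) 0 j *: (vbasis U)`_j).
    by rewrite mxE scaler_suml; apply: eq_bigr => i _; rewrite scalerA.
  by rewrite vA mxE scalerA.
Qed.

(** By induction on the dimension of U: a member of P which is not scalar on U has
    an eigenspace in U which is smaller, and stable because P commutes. *)
Lemma common_eigen (P : 'End(V) -> Prop) U : U != 0%VS ->
  (forall f, P f -> (f @: U <= U)%VS) ->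
  (forall f g, P f -> P g -> forall v, f (g v) = g (f v)) ->
  exists w, [/\ w \in U, w != 0 & forall f, P f -> exists c, f w = c *: w].
Proof.
move=> + + PC; have [n] := ubnP (\dim U); elim: n U => // n IH U ltn U0 PU.
have [sc|/existsNP [f /not_implyP [Pf nsc]]] := pselect (forall f, P f -> exists c, forall w, w \in U -> f w = c *: w).
  exists (vpick U); split; rewrite ?memv_pick ?vpick0 // => f Pf.
  by have [c hc] := sc f Pf; exists c; apply: hc; apply: memv_pick.
have [c [w [wU w0 fw]]] := eigen_exists U0 (PU f Pf).
pose U' := (U :&: lker (f - c *: \1%VF))%VS.
have U'E v : (v \in U') = (v \in U) && (f v == c *: v).
  by rewrite memv_cap memv_ker add_lfunE opp_lfunE scale_lfunE id_lfunE subr_eq0.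
have [|//||v []] := IH U'.
- rewrite ltnS in ltn; apply: leq_trans ltn; rewrite ltn_neqAle dimvS ?capvSl // andbT.
  rewrite (dimv_leqif_eq (capvSl _ _)); apply/eqP => e; apply: nsc; exists c => v vU.
  have vU' : v \in (U :&: lker (f - c *: \1%VF))%VS by rewrite e.
  by move: vU'; rewrite -/U' U'E => /andP [_ /eqP].
- by apply: contraNneq w0 => e; rewrite -memv0 -e U'E wU fw eqxx.
- move=> g Pg; apply/subvP => _ /memv_imgP [v + ->]; rewrite !U'E => /andP [vU /eqP fv].
  by rewrite PC // fv linearZ eqxx andbT; apply: (subvP (PU g Pg)); apply: memv_img.
- by rewrite U'E => /andP [vU _] v0 h; exists v.
Qed.

(** If c is not among the eigenvalues on a spanning family, then f - c maps that
    family onto a spanning one, so it is bijective. *)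
Lemma eigen_in_list (S : seq V) f (k : V -> K) c w : <<S>>%VS = fullv ->
  (forall s, s \in S -> f s = k s *: s) -> w != 0 -> f w = c *: w -> c \in map k S.
Proof.
move=> fS hS w0 fw; apply/negPn/negP => cS.
pose g := f - c *: \1%VF.
have gE v : g v = f v - c *: v by rewrite add_lfunE opp_lfunE scale_lfunE id_lfunE.
have im : limg g = fullv.
  apply/eqP; rewrite eqEsubv subvf -fS; apply/span_subvP => s hs.
  have ks : k s - c != 0.
    by rewrite subr_eq0; apply: contraNneq cS => <-; apply: map_f.
  have -> : s = g ((k s - c)^-1 *: s).
    by rewrite linearZ /= gE hS // -scalerBl scalerA mulVf // scale1r.
  by apply: memv_img; rewrite fS memvf.
have : \dim (lker g) == 0%N.
  by have := limg_ker_dim g fullv; rewrite im capfv => /(congr1 (subn^~ (\dim {:V}))); rewrite addnK subnn => ->.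
rewrite dimv_eq0 => /eqP kg; move/negP: w0; apply.
by rewrite -memv0 -kg memv_ker gE fw subrr.
Qed.

End Eigen.

Section Char0.
Variables (K : fieldType) (charK : [pchar K] =i pred0).

Lemma natr_eq0_char0 n : (n%:R == 0 :> K) = (n == 0)%N.
Proof. by move/pcharf0P: charK => ->. Qed.

Lemma intr_eq0_char0 (m : int) : (m%:~R == 0 :> K) = (m == 0).
Proof.
case: m => n; first by rewrite -pmulrn natr_eq0_char0.
by rewrite NegzE mulrNz oppr_eq0 -pmulrn natr_eq0_char0.
Qed.

Lemma intr_inj_char0 : injective (fun m : int => m%:~R : K).
Proof.
by move=> m n /= /eqP; rewrite -subr_eq0 -intrB intr_eq0_char0 subr_eq0 => /eqP.
Qed.
End Char0.

(** * Supermatrices and their actions *)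

Section SuperMatrix.
Variables (K : fieldType) (r : nat) (par : 'I_r -> bool).
Implicit Types (X Y : 'M[K]_r) (a b : bool) (s t : 'I_r).

Definition strace X : K := \sum_s (-1) ^+ par s * X s s.
Definition homog a X := forall s t, par s (+) par t != a -> X s t = 0.
Definition bracket a b X Y := X *m Y - (-1) ^+ (a && b) *: (Y *m X).
Definition dpart X : 'M[K]_r := \matrix_(s, t) if s == t then X s t else 0.

Lemma homog_delta s t : homog (par s (+) par t) (delta_mx s t).
Proof.
move=> u v; rewrite mxE; have [->|//] := eqVneq u s; have [->|//] := eqVneq v t.
by rewrite eqxx.
Qed.

Lemma strace_delta s t : s != t -> strace (delta_mx s t) = 0.
Proof.
move=> st; rewrite /strace big1 // => u _; rewrite mxE.
by have [->|] := eqVneq u s; rewrite ?(negPf st) mulr0.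
Qed.

Lemma strace_dpart X : strace (dpart X) = strace X.
Proof. by apply: eq_bigr => s _; rewrite mxE eqxx. Qed.

Lemma dpart_diag X s t : s != t -> dpart X s t = 0.
Proof. by rewrite mxE => /negPf ->. Qed.

Lemma homog_diag X : (forall s t, s != t -> X s t = 0) -> homog false X.
Proof. by move=> h s t st; apply: h; apply: contraNneq st => ->; rewrite addbb. Qed.

Lemma dpart_sum X : dpart X = \sum_s X s s *: delta_mx s s.
Proof.
apply/matrixP => i j; rewrite mxE summxE (bigD1 i) //= big1 => [|k ki].
  by rewrite !mxE eqxx /= addr0 eq_sym; case: eqP => [->|_]; rewrite ?mulr1 ?mulr0.
by rewrite !mxE eq_sym (negPf ki) mulr0.
Qed.

Lemma matrix_offdiag X :
  X = \sum_s \sum_(t | t != s) X s t *: delta_mx s t + dpart X.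
Proof.
rewrite dpart_sum {1}(matrix_sum_delta X) -big_split; apply: eq_bigr => s _ /=.
by rewrite (bigD1 s) //= addrC.
Qed.

Lemma diag_mul_delta X s t : (forall s t, s != t -> X s t = 0) ->
  X *m delta_mx s t = X s s *: delta_mx s t.
Proof.
move=> h; apply/matrixP => i j; rewrite !mxE (bigD1 s) //= big1 => [|k ks].
  rewrite mxE eqxx /= addr0; case: (eqVneq i s) => [->|/h -> //=]; first by rewrite ?eqxx.
  by rewrite mul0r mulr0.
by rewrite mxE (negPf ks) mulr0.
Qed.

Lemma delta_mul_diag X s t : (forall s t, s != t -> X s t = 0) ->
  delta_mx s t *m X = X t t *: delta_mx s t.
Proof.
move=> h; apply/matrixP => i j; rewrite !mxE (bigD1 t) //= big1 => [|k kt].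
  rewrite mxE eqxx andbT addr0; case: (eqVneq j t) => [->|jt].
    by rewrite andbT mulrC.
  by rewrite h 1?eq_sym // mulr0 andbF mulr0.
by rewrite mxE (negPf kt) andbF mul0r.
Qed.

(** Commuting with e_pj makes X diagonal in the rows other than p, and with e_jq
    in the columns other than q; the diagonal is constant, and it vanishes
    because the supertrace of X does and that of the identity does not. *)
Lemma centraliser p q a X : par p = par q -> p != q -> strace 1%:M != 0 ->
  homog a X -> strace X = 0 ->
  (forall j, j != p -> bracket (par p (+) par j) a (delta_mx p j) X = 0) ->
  (forall j, j != q -> bracket (par j (+) par q) a (delta_mx j q) X = 0) ->
  exists c, X = c *: delta_mx p q.
Proof.
move=> pq npq str1 hX sX hp hq.
have d_mul s t i j : (delta_mx s t *m X) i j = (i == s)%:R * X t j.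
  rewrite mxE (bigD1 t) //= big1 => [|k kt]; first by rewrite mxE eqxx andbT addr0.
  by rewrite mxE (negPf kt) andbF mul0r.
have mul_d s t i j : (X *m delta_mx s t) i j = X i s * (j == t)%:R.
  rewrite mxE (bigD1 s) //= big1 => [|k ks]; first by rewrite mxE eqxx addr0.
  by rewrite mxE (negPf ks) mulr0.
have brE b c (A B : 'M[K]_r) i j :
    bracket b c A B i j = (A *m B) i j - (-1) ^+ (b && c) * (B *m A) i j.
  by rewrite /bracket mxE; congr (_ + _); rewrite mxE; congr (- _); rewrite mxE.
have row j t : j != p -> t != j -> X j t = 0.
  move=> jp tj; have /matrixP /(_ p t) := hp j jp.
  by rewrite brE [RHS]mxE d_mul mul_d eqxx mul1r (negPf tj) mulr0 mulr0 subr0.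
have col j s : j != q -> s != j -> X s j = 0.
  move=> jq sj; have /matrixP /(_ s q) := hq j jq.
  rewrite brE [RHS]mxE d_mul mul_d eqxx mulr1 (negPf sj) mul0r sub0r => /eqP.
  by rewrite oppr_eq0 mulf_eq0 signr_eq0 => /eqP.
have off s t : s != t -> (s, t) != (p, q) -> X s t = 0.
  move=> st; rewrite xpair_eqE negb_and => /orP [sp|tq]; first by rewrite row // eq_sym.
  by rewrite col.
have dia j : X j j = X p p.
  have [->//|jp] := eqVneq j p.
  have /matrixP /(_ p j) := hp j jp.
  rewrite brE [RHS]mxE d_mul mul_d !eqxx mul1r mulr1 => /eqP; rewrite subr_eq0 => /eqP ->.
  case: (a) hX => hX; last by rewrite andbF mul1r.
  by rewrite hX ?addbb // mulr0.
have Xpp : X p p = 0.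
  move: sX; rewrite /strace (eq_bigr (fun s => X p p * ((-1) ^+ par s * (1%:M : 'M[K]_r) s s))).
    by rewrite -mulr_sumr => /eqP; rewrite mulf_eq0 (negPf str1) orbF => /eqP.
  by move=> s _; rewrite mxE eqxx mulr1 dia mulrC.
exists (X p q); apply/matrixP => s t; rewrite !mxE.
have [->|st] := eqVneq s t.
  rewrite dia Xpp; case: eqP => [->|]; last by rewrite mulr0.
  by rewrite (negPf npq) mulr0.
have [/eqP [-> ->]|spq] := boolP ((s, t) == (p, q)); first by rewrite !eqxx mulr1.
by rewrite off //; move: spq; rewrite xpair_eqE => /negPf ->; rewrite mulr0.
Qed.

Fact strace_is_linear : linear (strace : 'M[K]_r -> K^o).
Proof.
move=> c X Y; rewrite /strace scaler_sumr -big_split; apply: eq_bigr => s _ /=.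
by rewrite !mxE mulrDr; congr (_ + _); rewrite [RHS]mulrCA.
Qed.
HB.instance Definition _ := GRing.isLinear.Build K 'M[K]_r K^o _ _ strace_is_linear.

Lemma strace_bracket a b X Y : homog a X -> homog b Y ->
  strace (bracket a b X Y) = 0.
Proof.
move=> hX hY; rewrite /strace.
rewrite (eq_bigr (fun s => \sum_t (-1) ^+ par s * (X s t * Y t s) -
    \sum_t (-1) ^+ (a && b) * ((-1) ^+ par s * (Y s t * X t s)))); last first.
  move=> s _; rewrite !mxE mulrBr !mulr_sumr; congr (_ - _).
  by apply: eq_bigr => t _; rewrite mulrCA.
rewrite sumrB [X in _ - X]exchange_big -sumrB big1 // => s _; rewrite -sumrB big1 // => t _ /=.
have [e|/hX ->] := eqVneq (par s (+) par t) a; last by rewrite !(mul0r, mulr0) subrr.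
have [e'|/hY ->] := eqVneq (par t (+) par s) b; last by rewrite !(mul0r, mulr0) subrr.
rewrite -e -e' mulrA -signr_addb (mulrC (Y t s)).
by case: (par s) (par t) => [] []; rewrite subrr.
Qed.

Definition hpart a X : 'M[K]_r := \matrix_(s, t) if par s (+) par t == a then X s t else 0.

Lemma homog_hpart a X : homog a (hpart a X).
Proof. by move=> s t; rewrite mxE => /negPf ->. Qed.

Lemma hpartD a X : X = hpart a X + hpart (~~ a) X.
Proof.
apply/matrixP => s t; rewrite !mxE.
by case: (par s (+) par t); case: a; rewrite ?addr0 ?add0r.
Qed.

Lemma strace_hpart a X : strace X = 0 -> strace (hpart a X) = 0.
Proof.
rewrite /strace => h; case: a; last by rewrite -[RHS]h; apply: eq_bigr => s _; rewrite mxE addbb.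
by rewrite big1 // => s _; rewrite mxE addbb mulr0.
Qed.

End SuperMatrix.

(** A matrix representation of the special linear superalgebra which identifies
    it with Inder(F).  Taking rho on all matrices avoids the subspace of
    matrices with supertrace 0 as a type: only its values there are
    constrained. *)
Record sl_action (K : fieldType) (N : nat) (F : filippovSuperalgebra K N.+1)
    (r : nat) (par : 'I_r -> bool) (rho : 'M[K]_r -> 'End(F)) : Prop := SlAction {
  sla_gr : forall a X, strace par X = 0 -> homog par a X -> end_gr a (rho X);
  sla_br : forall a b X Y, strace par X = 0 -> strace par Y = 0 ->
    homog par a X -> homog par b Y ->
    rho (bracket a b X Y) =
      (rho X \o rho Y)%VF - (-1) ^+ (a && b) *: (rho Y \o rho X)%VF;
  sla_inj : forall X, strace par X = 0 -> rho X = 0 -> X = 0;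
  sla_inder : forall g, inder g <-> exists2 X, strace par X = 0 & g = rho X }.

Section Action.
Variables (K : closedFieldType) (charK : [pchar K] =i pred0).
Variables (N : nat) (F : filippovSuperalgebra K N.+1) (r : nat) (par : 'I_r -> bool).
Variable rho : {linear 'M[K]_r -> 'End(F)}.
Hypotheses (str1 : strace par (1%:M : 'M[K]_r) != 0) (act : sl_action par rho).
Hypothesis simF : fs_simple F.
Implicit Types (X Y : 'M[K]_r) (a b : bool) (v w : F) (s t : 'I_r).

Local Notation e_ s t := (rho (delta_mx s t)).

Lemma rho_mul a b X Y w : strace par X = 0 -> strace par Y = 0 ->
  homog par a X -> homog par b Y ->
  rho X (rho Y w) = (-1) ^+ (a && b) *: rho Y (rho X w) + rho (bracket a b X Y) w.
Proof.
move=> sX sY hX hY; rewrite (sla_br act sX sY hX hY).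
by rewrite add_lfunE opp_lfunE scale_lfunE !comp_lfunE addrC subrK.
Qed.

Lemma e_gr s t b w : s != t -> w \in fs_gr F b ->
  e_ s t w \in fs_gr F (par s (+) par t (+) b).
Proof.
by move=> st hw; apply: (sla_gr act (@strace_delta K r par _ _ st) (@homog_delta K r par s t)).
Qed.

Lemma e_mul s t (u v : 'I_r) w : s != t -> u != v ->
  e_ s t (e_ u v w) =
    (-1) ^+ ((par s (+) par t) && (par u (+) par v)) *: e_ u v (e_ s t w)
    + rho (delta_mx s v *+ (t == u)
      - (-1) ^+ ((par s (+) par t) && (par u (+) par v)) *: (delta_mx u t *+ (v == s))) w.
Proof.
move=> st uv; rewrite (rho_mul w (@strace_delta K r par _ _ st) (@strace_delta K r par _ _ uv)
  (@homog_delta K r par s t) (@homog_delta K r par u v)).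
by rewrite /bracket !mul_delta_mx_cond.
Qed.

Lemma rho_decomp X w :
  rho X w = \sum_s \sum_(t | t != s) X s t *: e_ s t w + rho (dpart X) w.
Proof.
rewrite {1}[X]matrix_offdiag linearD add_lfunE; congr (_ + _).
rewrite linear_sum sum_lfunE; apply: eq_bigr => s _.
rewrite linear_sum sum_lfunE; apply: eq_bigr => t _.
by rewrite linearZ /= scale_lfunE.
Qed.

Definition diag_sl X := strace par X = 0 /\ forall s t, s != t -> X s t = 0.

Definition weight_vec b w := w \in fs_gr F b /\
  forall X, diag_sl X -> exists c, rho X w = c *: w.

Lemma diag_e X c w s t : s != t -> diag_sl X -> rho X w = c *: w ->
  rho X (e_ s t w) = (c + X s s - X t t) *: e_ s t w.
Proof.
move=> st [sX dX] hw.
rewrite (rho_mul w sX (@strace_delta K r par _ _ st) (homog_diag dX) (@homog_delta K r par s t)).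
rewrite scale1r hw linearZ /= /bracket scale1r diag_mul_delta // delta_mul_diag //.
by rewrite -scalerBl linearZ /= scale_lfunE -scalerDl addrA.
Qed.

Lemma weight_vec_e b w s t : s != t -> weight_vec b w -> weight_vec (par s (+) par t (+) b) (e_ s t w).
Proof.
move=> st [wb hw]; split=> [|X dX]; first exact: e_gr.
have [c hc] := hw X dX; exists (c + X s s - X t t); exact: diag_e.
Qed.

Lemma rho_weight_vec_span (S : seq F) X w b : strace par X = 0 -> weight_vec b w ->
  (forall c v, weight_vec c v -> v \in <<S>>%VS) -> rho X w \in <<S>>%VS.
Proof.
move=> sX hw hS; rewrite rho_decomp memvD //.
  apply: memv_suml => s _; apply: memv_suml => t ts; rewrite memvZ //.
  by apply: hS; apply: weight_vec_e hw; rewrite eq_sym.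
have [c ->] : exists c, rho (dpart X) w = c *: w.
  by apply: hw.2; split; [rewrite strace_dpart | exact: dpart_diag].
by rewrite memvZ // (hS b).
Qed.

Lemma exists_weight_vec b : fs_gr F b != 0%VS -> exists2 w, w != 0 & weight_vec b w.
Proof.
move=> gb.
have [|f g [X [sX dX] ->] [Y [sY dY] ->] v|w [wb w0 hw]] :=
    @common_eigen K F (fun f => exists2 X, diag_sl X & f = rho X) _ gb.
- move=> f [X [sX dX] ->]; apply/subvP => _ /memv_imgP [v vb ->].
  exact: (sla_gr act sX (homog_diag dX) vb).
- rewrite (rho_mul v sX sY (homog_diag dX) (homog_diag dY)) scale1r.
  suff -> : bracket false false X Y = 0 by rewrite linear0 zero_lfunE addr0.
  apply/matrixP => s t; rewrite /bracket scale1r !mxE (bigD1 s) //= big1 => [|k ks].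
    rewrite (bigD1 t) //= big1 => [|k kt]; last by rewrite dX ?mulr0 // eq_sym.
    have [->|st] := eqVneq s t; first by rewrite mulrC subrr.
    by rewrite (dY _ _ st) !(mulr0, mul0r, addr0, subr0).
  by rewrite dX ?mul0r // eq_sym.
- by exists w => //; split=> // X dX; apply: hw; exists X.
Qed.

(** The weight vectors span an ideal, as matrix units map weight vectors to weight
    vectors; it is not 0, as diagonal matrices commute and thus have a common
    eigenvector. *)
Lemma weight_vec_span : exists2 S : seq F, <<S>>%VS = fullv &
  forall w, w \in S -> w != 0 /\ exists b, weight_vec b w.
Proof.
pose P n := `[< exists S : seq F, (forall w, w \in S -> exists b, weight_vec b w) /\ \dim <<S>> = n >].
have exP : exists n, P n by exists 0%N; apply/asboolP; exists [::]; rewrite span_nil dimv0.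
have leP n : P n -> (n <= \dim {:F})%N.
  by move=> /asboolP [S [_ <-]]; apply: dimvS; apply: subvf.
case: (ex_maxnP exP leP) => n /asboolP [S [hS dS]] maxn.
have all_in b w : weight_vec b w -> w \in <<S>>%VS.
  move=> hw; have /maxn : P (\dim <<w :: S>>).
    apply/asboolP; exists (w :: S); split=> // u; rewrite inE => /predU1P [->|/hS //].
    by exists b.
  rewrite -dS => le; have sub : (<<S>> <= <<w :: S>>)%VS by rewrite span_cons addvSr.
  have /eqP -> : <<S>>%VS == <<w :: S>>%VS.
    by rewrite -(dimv_leqif_eq sub) eqn_leq le dimvS.
  by rewrite span_cons memvE addvSl.
have id : fs_ideal <<S>>%VS.
  apply: span_ideal => [s /hS [b [sb _]]|g /(sla_inder act) [X sX ->] s /hS [b hs]]; first by exists b.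
  by apply: rho_weight_vec_span hs all_in.
have fS : <<S>>%VS = fullv.
  case: (simF.2 _ id) => // S0; exfalso.
  have [b gb] : exists b, fs_gr F b != 0%VS.
    have [[x hx] _] := simF.
    case: (eqVneq (fs_gr F false) 0%VS) => [e0|]; last by exists false.
    case: (eqVneq (fs_gr F true) 0%VS) => [e1|]; last by exists true.
    by case: hx; apply/eqP; rewrite -memv0 -(addv0 0%VS) -{1}e0 -e1 fs_gr_sum memvf.
  have [w w0 hw] := exists_weight_vec gb.
  by move: (all_in _ _ hw); rewrite S0 memv0 (negPf w0).
exists [seq w <- S | w != 0]; last by move=> w; rewrite mem_filter => /andP [w0 /hS].
apply/eqP; rewrite eqEsubv subvf -fS; apply/span_subvP => w wS.
have [->|w0] := eqVneq w 0; first by rewrite mem0v.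
by rewrite memv_span // mem_filter w0.
Qed.

Lemma sl_ann_eq0 b w : w \in fs_gr F b -> (forall X, strace par X = 0 -> rho X w = 0) -> w = 0.
Proof.
by move=> wb h; apply: (simple_ann simF wb) => g /(sla_inder act) [X sX ->]; apply: h.
Qed.

End Action.

(** * The weights of an even root *)

Section Pair.
Variables (K : closedFieldType) (charK : [pchar K] =i pred0).
Variables (N : nat) (F : filippovSuperalgebra K N.+1) (r : nat) (par : 'I_r -> bool).
Variable rho : {linear 'M[K]_r -> 'End(F)}.
Hypotheses (str1 : strace par (1%:M : 'M[K]_r) != 0) (act : sl_action par rho).
Hypothesis simF : fs_simple F.
Variables (p q : 'I_r).
Hypotheses (pq : par p = par q) (npq : p != q).
Implicit Types (X Y : 'M[K]_r) (a b c : bool) (v w : F) (s t : 'I_r).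

Local Notation e_ s t := (rho (delta_mx s t)).
Local Notation wvec := (weight_vec par rho).

Definition hmatrix : 'M[K]_r := delta_mx p p - delta_mx q q.
(** The diagonal entries of [hmatrix], so that the root vector e_st has weight
    hcoef s - hcoef t. *)
Definition hcoef s : int := (s == p)%:Z - (s == q)%:Z.
Definition hweight (k : int) (w : F) := rho hmatrix w = k%:~R *: w.

Lemma hmatrixE s t : hmatrix s t = if s == t then (hcoef s)%:~R else 0.
Proof.
rewrite !mxE /hcoef intrB !pmulrn; have [->|st] := eqVneq s t; first by rewrite !andbb.
have off u : (s == u) && (t == u) = false by apply: contraNF st => /andP [/eqP -> /eqP ->].
by rewrite !off subrr.
Qed.

Lemma hmatrix_sl : diag_sl par hmatrix.
Proof.
split=> [|s t st]; last by rewrite hmatrixE (negPf st).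
rewrite /hmatrix linearB /= /strace (bigD1 p) //= [X in _ - X](bigD1 q) //= !mxE !eqxx -pq.
by rewrite !big1 ?addr0 ?subrr // => s sp; rewrite mxE (negPf sp) mulr0.
Qed.

Lemma hweight_e k w s t : s != t -> hweight k w -> hweight (k + hcoef s - hcoef t) (e_ s t w).
Proof.
move=> st hk; have := diag_e act st hmatrix_sl hk; rewrite !hmatrixE !eqxx /hweight => ->.
by rewrite -intrD -intrB.
Qed.

Lemma hcoef_p : hcoef p = 1. Proof. by rewrite /hcoef eqxx (negPf npq). Qed.
Lemma hcoef_q : hcoef q = -1. Proof. by rewrite /hcoef eqxx eq_sym (negPf npq). Qed.

Lemma ef w : e_ p q (e_ q p w) = e_ q p (e_ p q w) + rho hmatrix w.
Proof.
rewrite (e_mul act w npq) 1?eq_sym // pq addbb !eqxx !scale1r !mulr1n.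
by [].
Qed.

Lemma hweight_ef k w : hweight k w -> e_ p q w = 0 -> e_ p q (e_ q p w) = k%:~R *: w.
Proof. by move=> hk e0; rewrite ef e0 linear0 add0r hk. Qed.

(** The eigenvalues of the u i are distinct in characteristic 0, and h has only
    finitely many eigenvalues. *)
Lemma string_stops (u : nat -> F) (l d : K) : d != 0 -> u 0%N != 0 ->
  (forall i, rho hmatrix (u i) = (l + d *+ i) *: u i) ->
  exists i, u i != 0 /\ u i.+1 = 0.
Proof.
move=> d0 u0 hu; have [S fS hS] := weight_vec_span act simF.
have /choice [k hk] (s : F) : exists k, s \in S -> rho hmatrix s = k *: s.
  have [sS|] := boolP (s \in S); last by exists 0.
  by have [_ [b [_ /(_ _ hmatrix_sl) [k ->]]]] := hS s sS; exists k.
have [i /eqP ui] : exists i, u i == 0.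
  apply: contrapT => /forallNP un0.
  have sub : {subset [seq l + d *+ i | i <- iota 0 (size S).+1] <= map k S}.
    move=> _ /mapP [i _ ->]; apply: eigen_in_list fS hk _ (hu i).
    by apply/negP/un0.
  have uq : uniq [seq l + d *+ i | i <- iota 0 (size S).+1].
    rewrite map_inj_uniq ?iota_uniq // => i j /addrI /eqP.
    rewrite -subr_eq0; wlog ij : i j / (i <= j)%N => [H|].
      by case: (leqP i j) => [/H//|/ltnW /H h]; rewrite -opprB oppr_eq0 => /h ->.
    rewrite -opprB oppr_eq0 -mulrnBr // -mulr_natr mulf_eq0 (negPf d0) /= natr_eq0_char0 //.
    by rewrite subn_eq0 => ji; apply/eqP; rewrite eqn_leq ij ji.
  by have := uniq_leq_size uq sub; rewrite !size_map size_iota ltnn.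
have exi : exists i, u i == 0 by exists i; rewrite ui.
case: (ex_minnP exi) => [[|j]] /eqP uj minj; first by rewrite uj eqxx in u0.
by exists j; split=> //; apply/negP => /minj; rewrite ltnn.
Qed.

(** The usual argument for sl_2: apply e to w until the next step gives 0, then
    apply f until the next step gives 0.  The eigenvalue of h at the top equals
    the number of the latter steps. *)
Lemma int_weight b w : w != 0 -> wvec b w -> exists k, hweight k w.
Proof.
move=> w0 [_ /(_ _ hmatrix_sl) [l hl]].
have n2 : (2 : K) != 0 by rewrite (natr_eq0_char0 charK 2).
have hE l' u s t : s != t -> rho hmatrix u = l' *: u ->
    rho hmatrix (e_ s t u) = (l' + (hcoef s)%:~R - (hcoef t)%:~R) *: e_ s t u.
  by move=> st h; rewrite (diag_e act st hmatrix_sl h) !hmatrixE !eqxx.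
have nqp : q != p by rewrite eq_sym.
have [i|i [ui /= uS]] := @string_stops (fun i => iter i (e_ p q) w) l 2 n2 w0.
  elim: i => [|i IH]; first by rewrite mulr0n addr0.
  rewrite iterS (hE _ _ _ _ npq IH) hcoef_p hcoef_q mulrSr; congr (_ *: _).
  by rewrite mulrN1z opprK; ring.
set u := iter i _ w in ui uS; set m := l + 2 *+ i.
have hu : rho hmatrix u = m *: u.
  rewrite /u /m; elim: i {ui uS u m} => [|i IH]; first by rewrite mulr0n addr0.
  rewrite iterS (hE _ _ _ _ npq IH) hcoef_p hcoef_q mulrSr; congr (_ *: _).
  by rewrite mulrN1z opprK; ring.
have hf j : rho hmatrix (iter j (e_ q p) u) = (m + (-2) *+ j) *: iter j (e_ q p) u.
  elim: j => [|j IH]; first by rewrite mulr0n addr0.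
  rewrite iterS (hE _ _ _ _ nqp IH) hcoef_p hcoef_q mulrSr; congr (_ *: _).
  by rewrite mulrN1z; ring.
have hef j : e_ p q (iter j.+1 (e_ q p) u) = (j.+1%:R * (m - j%:R)) *: iter j (e_ q p) u.
  elim: j => [|j IH]; first by rewrite /= ef uS linear0 add0r hu mul1r subr0.
  rewrite iterS ef IH linearZ /= -iterS hf -scalerDl; congr (_ *: _).
  by rewrite -[in RHS]natr1 -[j.+1%:R]natr1 -mulr_natr; ring.
have [|j [uj ujS]] := @string_stops (fun j => iter j (e_ q p) u) m (-2) _ ui hf.
  by rewrite oppr_eq0.
have := hef j; rewrite ujS linear0 => /esym /eqP.
rewrite scaler_eq0 (negPf uj) orbF mulf_eq0 natr_eq0_char0 //= subr_eq0 /m => /eqP e.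
exists (j%:Z - (2 * i)%:Z); rewrite /hweight hl; congr (_ *: _).
by rewrite intrB -!pmulrn natrM -e -[2 *+ i]mulr_natr; ring.
Qed.

Lemma top_weight : exists k b x0, [/\ wvec b x0, x0 != 0, hweight k x0 &
  forall w (t : int), w != 0 -> hweight t w -> t <= k].
Proof.
have [S fS hS] := weight_vec_span act simF.
have /choice [k hk] (s : F) : exists k : int, s \in S -> hweight k s.
  have [sS|] := boolP (s \in S); last by exists 0.
  by have [s0 [b hb]] := hS s sS; have [k hk] := int_weight s0 hb; exists k.
have [S0|] := eqVneq S [::].
  have [[x hx] _] := simF; case: hx; apply/eqP.
  by rewrite -memv0 -span_nil -S0 fS memvf.
case: S fS hS hk => // s0 S fS hS hk _.
have mx : exists2 s : F, s \in s0 :: S & forall s' : F, s' \in s0 :: S -> k s' <= k s.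
  elim: (S) (s0) => [|s' S' IH] s; first by exists s; rewrite ?inE // => s'; rewrite inE => /eqP ->.
  have [m ms hm] := IH s'; have [le|lt] := leP (k s) (k m).
    exists m; first by rewrite inE ms orbT.
    by move=> u; rewrite inE => /predU1P [->|/hm].
  exists s; first by rewrite inE eqxx.
  by move=> u; rewrite inE => /predU1P [->//|/hm /le_trans]; apply; apply: ltW.
have [s sS hs] := mx; have [s1 [b hb]] := hS s sS.
exists (k s), b, s; split=> //; first exact: hk.
move=> w t w0 ht.
have /mapP [u uS /(intr_inj_char0 charK) ->] : t%:~R \in map (fun s : F => (k s)%:~R : K) (s0 :: S).
  exact: eigen_in_list fS hk w0 ht.
exact: hs.
Qed.

End Pair.

(** * Tuples of weight vectors *)

Section Args.
Variables (K : closedFieldType) (charK : [pchar K] =i pred0).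
Variables (N : nat) (F : filippovSuperalgebra K N.+1) (r : nat) (par : 'I_r -> bool).
Variable rho : {linear 'M[K]_r -> 'End(F)}.
Hypotheses (str1 : strace par (1%:M : 'M[K]_r) != 0) (act : sl_action par rho).
Hypothesis simF : fs_simple F.
Variables (p q : 'I_r).
Hypotheses (pq : par p = par q) (npq : p != q).
Implicit Types (X Y : 'M[K]_r) (a b c : bool) (v w : F) (s t : 'I_r).
Implicit Types (x : {ffun 'I_N.+1 -> F}) (pr : 'I_N.+1 -> bool) (mu : 'I_N.+1 -> int).

Local Notation e_ s t := (rho (delta_mx s t)).
Local Notation wvec := (weight_vec par rho).
Local Notation hw := (hweight rho p q).
Local Notation hwt := (hcoef p q).
Local Notation hmx := (hmatrix K p q).
Local Notation parity pr := (\big[addb/false]_(i | i != ord0) pr i).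
Local Notation degree mu := (\sum_(i | i != ord0) mu i).

Definition weight_args x pr mu := forall i, i != ord0 -> wvec (pr i) (x i) /\ hw (mu i) (x i).

(** The counterpart of [upd] for the parities and the weights of a tuple. *)
Definition fupd T (f : 'I_N.+1 -> T) i (y : T) := fun j => if j == i then y else f j.

Lemma weight_args_upd x pr mu i u c k : weight_args x pr mu -> wvec c u -> hw k u ->
  weight_args (upd x i u) (fupd pr i c) (fupd mu i k).
Proof. by move=> hx hu ku j j0; rewrite ffunE /fupd; case: eqP => // _; apply: hx. Qed.

Lemma parity_fupd pr i c : i != ord0 ->
  parity (fupd pr i c) = parity pr (+) pr i (+) c.
Proof.
move=> i0; rewrite (bigD1 i) //= [X in _ = X (+) _ (+) _](bigD1 i) //= /fupd eqxx.
rewrite (eq_bigr pr) => [|j /andP [_ /negPf ->] //].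
by case: (pr i) c => [] []; case: (\big[_/_]_(_ | _) _).
Qed.

Lemma degree_fupd mu i k : i != ord0 -> degree (fupd mu i k) = degree mu - mu i + k.
Proof.
move=> i0; rewrite (bigD1 i) //= [X in _ = X - _ + _](bigD1 i) //= /fupd eqxx.
rewrite (eq_bigr mu) => [|j /andP [_ /negPf ->] //].
by rewrite [mu i + _]addrC addrK addrC.
Qed.

Lemma weight_args_homog x pr mu i : weight_args x pr mu -> i != ord0 -> x i \in fs_gr F (pr i).
Proof. by move=> hx /hx [] []. Qed.

(** The derivation rule when the argument of the operator is in position 0: its
    term has no sign. *)
Lemma rho_slot b Y x pr mu c u : strace par Y = 0 -> homog par b Y ->
  weight_args x pr mu -> u \in fs_gr F c ->
  rho Y (slot x ord0 u) = slot x ord0 (rho Y u) +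
    \sum_(i | i != ord0)
      (-1) ^+ (b && \big[addb/false]_(j < N.+1 | (j < i)%N) fupd pr ord0 c j)
        *: slot (upd x i (rho Y (x i))) ord0 u.
Proof.
move=> sY hY hx hu.
have hD : superder b (rho Y).
  by apply: inder_superder; [apply/(sla_inder act); exists Y | apply: (sla_gr act)].
have hx' : homog_args (upd x ord0 u) (fupd pr ord0 c).
  by move=> i; rewrite ffunE /fupd; case: eqVneq => // /(weight_args_homog hx).
rewrite (hD _ _ hx') (bigD1 ord0) //= big_pred0 => [|j]; last by rewrite ltn0.
rewrite andbF scale1r upd_same upd_upd; congr (_ + _); apply: eq_bigr => i i0.
by rewrite (upd_other _ _ i0) updC 1?eq_sym // -/(slot _ ord0 u).
Qed.

Lemma rho_slot_even Y x pr mu c u : strace par Y = 0 -> homog par false Y ->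
  weight_args x pr mu -> u \in fs_gr F c ->
  rho Y (slot x ord0 u) = slot x ord0 (rho Y u) +
    \sum_(i | i != ord0) slot (upd x i (rho Y (x i))) ord0 u.
Proof.
move=> sY hY hx hu; rewrite (rho_slot sY hY hx hu); congr (_ + _).
by apply: eq_bigr => i _; rewrite /= scale1r.
Qed.

Lemma slot_updZ x i k u : i != ord0 -> slot (upd x i (k *: x i)) ord0 u = k *: slot x ord0 u.
Proof. by move=> i0; rewrite /slot updC // br_updZ updC 1?eq_sym // upd_id. Qed.

Lemma rho_bracket a b X Y w : strace par X = 0 -> strace par Y = 0 ->
  homog par a X -> homog par b Y ->
  rho (bracket a b X Y) w = rho X (rho Y w) - (-1) ^+ (a && b) *: rho Y (rho X w).
Proof.
move=> sX sY hX hY; rewrite (sla_br act sX sY hX hY).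
by rewrite add_lfunE opp_lfunE scale_lfunE !comp_lfunE.
Qed.

(** An inner derivation is given by a matrix X.  Both its parity and its weight
    are known, and since rho is injective they restrict the nonzero entries
    of X. *)
Lemma weight_args_matrix x pr mu : weight_args x pr mu -> exists X, [/\ strace par X = 0,
  homog par (parity pr) X, left_op x (parity pr) = rho X &
  forall s t, X s t != 0 -> hwt s - hwt t = degree mu].
Proof.
move=> hx; set P := parity pr.
have hx' i : i != ord0 -> x i \in fs_gr F (pr i) by apply: weight_args_homog hx.
have /(sla_inder act) [X0 sX0 lX0] := inder_left_op hx'; rewrite -/P in lX0.
pose X := hpart par P X0.
have sX : strace par X = 0 by apply: strace_hpart.
have hX : homog par P X by apply: homog_hpart.
have X1 : hpart par (~~ P) X0 = 0.
  apply: (sla_inj act); first exact: strace_hpart.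
  apply: (@end_gr_two_parities _ _ _ P).
    have -> : rho (hpart par (~~ P) X0) = (-1) *: rho X + rho X0.
      by rewrite [in X in _ = _ + X](hpartD par P X0) linearD scaleN1r addKr.
    apply: end_gr_lin; last by rewrite -lX0; apply: left_op_gr hx'.
    exact: (sla_gr act sX hX).
  by apply: (sla_gr act); [apply: strace_hpart | apply: homog_hpart].
have lX : left_op x P = rho X by rewrite lX0 [in LHS](hpartD par P X0) X1 addr0.
exists X; split=> // s t Xst; clearbody X.
have [sh dh] := hmatrix_sl K pq.
have hh := homog_diag (par := par) dh.
pose Z := bracket false P hmx X - (degree mu)%:~R *: X.
have Z0 : Z = 0.
  apply: (sla_inj act).
    rewrite (linearB (strace par : 'M_r -> K^o)) linearZ /= sX scaler0 subr0.
    exact: strace_bracket.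
  apply/lfunP => w; rewrite zero_lfunE; move: w.
  apply: (eq_on_homog (F := F)) => [u v|u v|c u hu]; [exact: linearD | by rewrite addr0 |].
  have -> : rho Z u = rho hmx (left_op x P u) - left_op x P (rho hmx u)
      - (degree mu)%:~R *: left_op x P u.
    rewrite lX /Z linearB linearZ /= [LHS]add_lfunE opp_lfunE scale_lfunE.
    by rewrite rho_bracket // scale1r.
  have hhu : rho hmx u \in fs_gr F c by apply: (sla_gr act sh hh).
  rewrite (left_opE _ _ hhu) (left_opE _ _ hu) linearZ /= (rho_slot_even sh hh hx hu).
  rewrite (eq_bigr (fun i => (mu i)%:~R *: slot x ord0 u)); last first.
    by move=> i i0; rewrite (hx i i0).2 slot_updZ.
  rewrite -scaler_suml -rmorph_sum.
  by rewrite scalerDr [X in X - _]addrAC subrr add0r scalerA mulrC -scalerA subrr.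
have /matrixP /(_ s t) := Z0; rewrite /Z /bracket scale1r.
have hXst : (hmx *m X) s t = (hwt s)%:~R * X s t.
  rewrite mxE (bigD1 s) //= big1 ?addr0 ?hmatrixE ?eqxx // => k ks.
  by rewrite hmatrixE eq_sym (negPf ks) mul0r.
have Xhst : (X *m hmx) s t = X s t * (hwt t)%:~R.
  rewrite mxE (bigD1 t) //= big1 ?addr0 ?hmatrixE ?eqxx // => k kt.
  by rewrite hmatrixE (negPf kt) mulr0.
rewrite [LHS]mxE [X in X + _]mxE hXst [X in _ + X + _]mxE Xhst ![X in _ + X]mxE mxE.
rewrite !mxE (mulrC (X s t)) -mulrBl -mulrBl => /eqP.
by rewrite mulf_eq0 (negPf Xst) orbF -!intrB intr_eq0_char0 // subr_eq0 => /eqP.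
Qed.

Lemma slot_nonzero_gr x : (exists u, slot x ord0 u != 0) ->
  exists c u, u \in fs_gr F c /\ slot x ord0 u != 0.
Proof.
case=> u; have [u0 [u1 [h0 h1 ->]]] := gr_decomp u; rewrite linearD /=.
have [->|] := eqVneq (slot x ord0 u0) 0; first by rewrite add0r; exists true, u1.
by exists false, u0.
Qed.

Lemma hcoef_bound s t : -2 <= hwt s - hwt t <= 2.
Proof. by rewrite /hcoef; case: (s == p) (s == q) (t == p) (t == q) => [] [] [] []. Qed.

Lemma hcoef_top s t : hwt s - hwt t = 2 -> s = p /\ t = q.
Proof.
rewrite /hcoef; case: (eqVneq s p) => [->|_]; case: (eqVneq t q) => [->|_] //.
all: by case: (_ == q); case: (_ == p).
Qed.

Lemma degree_bound x pr mu : weight_args x pr mu -> (exists u, slot x ord0 u != 0) ->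
  -2 <= degree mu <= 2.
Proof.
move=> hx /slot_nonzero_gr [c [u [hu un0]]]; have [X [sX hX lX wX]] := weight_args_matrix hx.
have [X0|] := eqVneq X 0.
  move: lX; rewrite X0 linear0 => /lfunP /(_ u) /eqP.
  by rewrite (left_opE _ _ hu) zero_lfunE scaler_eq0 signr_eq0 (negPf un0).
have [/existsP [s /existsP [t Xst]] _|/existsPn h] := boolP [exists s, exists t, X s t != 0].
  by rewrite -(wX s t Xst) hcoef_bound.
case/eqP; apply/matrixP => s t; rewrite mxE; apply/eqP/negPn.
by have /existsPn := h s; apply.
Qed.

(** The root vector e_pq is the only one of weight 2; it is even. *)
Lemma degree2 x pr mu : weight_args x pr mu -> degree mu = 2 ->
  exists c : K, forall u, slot x ord0 u = c *: e_ p q u.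
Proof.
move=> hx dmu; have [X [sX hX lX wX]] := weight_args_matrix hx.
have Xpq : X = X p q *: delta_mx p q.
  apply/matrixP => s t; rewrite !mxE.
  have [[-> ->]|st] : (s = p /\ t = q) \/ ~ (s = p /\ t = q) by apply: lem.
    by rewrite !eqxx mulr1.
  have -> : X s t = 0.
    by apply/eqP; apply: contrapT => /negP /wX; rewrite dmu => /hcoef_top.
  case: eqP => [sp|_]; last by rewrite mulr0.
  by case: eqP => [tq|_]; [case: st | rewrite mulr0].
have [P1|P0] := boolP (parity pr).
  have X0 : X = 0 by rewrite Xpq hX ?scale0r // pq addbb P1.
  exists 0; apply: (eq_on_homog (F := F)) => [u v|u v|c u hu].
  - exact: linearD.
  - by rewrite !scale0r addr0.
  have /lfunP /(_ u) := lX; rewrite (left_opE _ _ hu) X0 linear0 zero_lfunE scale0r => /eqP.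
  by rewrite scaler_eq0 signr_eq0 => /eqP.
exists (X p q); apply: (eq_on_homog (F := F)) => [u v|u v|c u hu].
- exact: linearD.
- by rewrite linearD scalerDr.
have /lfunP /(_ u) := lX; rewrite (left_opE _ _ hu) (negPf P0) scale1r => ->.
by rewrite {1}Xpq linearZ /= scale_lfunE.
Qed.

Definition raising s t := (s = p /\ t != p) \/ (t = q /\ s != q).

Lemma raising_hcoef s t : raising s t -> s != t /\ 0 < hwt s - hwt t.
Proof.
have nqp : q != p by rewrite eq_sym.
rewrite /hcoef => -[[-> tp]|[-> sq]]; split=> //.
- by rewrite eq_sym.
- by rewrite eqxx (negPf npq) (negPf tp); case: (t == q).
- by rewrite eqxx (negPf nqp) (negPf sq); case: (s == p).
Qed.

(** Otherwise the operator would commute with all raising root vectors, as they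
    kill the entry x i1 of greatest weight, and so be a multiple of e_pq, which
    has weight 2. *)
Lemma raise_weight_args x pr mu (i1 : 'I_N.+1) (k : int) : i1 != ord0 -> mu i1 = k ->
  (forall w (l : int), w != 0 -> hw l w -> l <= k) ->
  weight_args x pr mu -> (exists u, slot x ord0 u != 0) -> degree mu != 2 ->
  exists i s t, [/\ i != ord0, i != i1, raising s t &
    exists u, slot (upd x i (e_ s t (x i))) ord0 u != 0].
Proof.
move=> i10 mu1 top hx hn d2; apply: contrapT => H.
have [X [sX hX lX wX]] := weight_args_matrix hx.
have [c [u [hu un0]]] := slot_nonzero_gr hn.
have brX s t : raising s t -> bracket (par s (+) par t) (parity pr) (delta_mx s t) X = 0.
  move=> rst; have [st lst] := raising_hcoef rst.
  have sE := @strace_delta K r par _ _ st; have hE := @homog_delta K r par s t.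
  have kill (i : 'I_N.+1) v : i != ord0 -> slot (upd x i (e_ s t (x i))) ord0 v = 0.
    move=> i0; have [->|i1n] := eqVneq i i1.
      have -> : e_ s t (x i1) = 0.
        apply/eqP; apply: contrapT => /negP n0.
        have := top _ _ n0 (hweight_e act pq st (hx i1 i10).2); rewrite mu1.
        by rewrite -addrA gerDl => /(lt_le_trans lst); rewrite ltxx.
      by have := slot_updZ x 0 v i10; rewrite !scale0r.
    by apply/eqP; apply: contrapT => /negP n0; apply: H; exists i, s, t; split=> //; exists v.
  apply: (sla_inj act); first exact: strace_bracket.
  apply/lfunP => v; rewrite zero_lfunE; move: v.
  apply: (eq_on_homog (F := F)) => [v w|v w|d v hv]; [exact: linearD | by rewrite addr0 |].
  rewrite rho_bracket // -lX (left_opE _ _ hv) (left_opE _ _ (e_gr act st hv)) linearZ /=.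
  rewrite (rho_slot sE hE hx hv) [X in _ *: (_ + X)]big1 ?addr0 => [|i i0]; last by rewrite kill // scaler0.
  rewrite scalerA -signr_addb -scalerBl.
  by case: (parity pr) (d) (par s) (par t) => [] [] [] []; rewrite subrr scale0r.
have [d Xd] : exists d, X = d *: delta_mx p q.
  apply: (centraliser (par := par) (a := parity pr)) => // j jn; apply: brX.
    by left.
  by right.
have [d0|d0] := eqVneq d 0.
  move: lX; rewrite Xd d0 scale0r linear0 => /lfunP /(_ u) /eqP.
  by rewrite (left_opE _ _ hu) zero_lfunE scaler_eq0 signr_eq0 (negPf un0).
case/eqP: d2; rewrite -(wX p q); last by rewrite Xd !mxE !eqxx mulr1.
by rewrite hcoef_p // hcoef_q.
Qed.

End Args.

(** * Vectors of greatest weight *)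

Section Top.
Variables (K : closedFieldType) (charK : [pchar K] =i pred0).
Variables (N : nat) (F : filippovSuperalgebra K N.+1) (r : nat) (par : 'I_r -> bool).
Variable rho : {linear 'M[K]_r -> 'End(F)}.
Hypotheses (str1 : strace par (1%:M : 'M[K]_r) != 0) (act : sl_action par rho).
Hypothesis simF : fs_simple F.
Variables (p q : 'I_r).
Hypotheses (pq : par p = par q) (npq : p != q).
Implicit Types (X Y : 'M[K]_r) (a b : bool) (v w : F) (s t : 'I_r).
Implicit Types (x : {ffun 'I_N.+1 -> F}) (pr : 'I_N.+1 -> bool) (mu : 'I_N.+1 -> int).

Local Notation e_ s t := (rho (delta_mx s t)).
Local Notation wvec := (weight_vec par rho).
Local Notation hw := (hweight rho p q).
Local Notation hwt := (hcoef p q).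
Local Notation hmx := (hmatrix K p q).
Local Notation parity pr := (\big[addb/false]_(i | i != ord0) pr i).
Local Notation degree mu := (\sum_(i | i != ord0) mu i).

Local Notation args := (weight_args par rho p q).
Variables (i1 : 'I_N.+1).
Hypothesis i10 : i1 != ord0.

Lemma neq_qp : q != p. Proof. by rewrite eq_sym. Qed.

(** The argument of the operator and one of its entries may be exchanged. *)
Lemma slot_swap x pr mu i a b u v : args x pr mu -> i != ord0 ->
  u \in fs_gr F a -> v \in fs_gr F b ->
  exists2 s : bool, slot (upd x i u) ord0 v = (-1) ^+ s *: slot (upd x i v) ord0 u
    & (a = b -> s = ~~ a).
Proof.
move=> hx i0 hu hv.
have hz : homog_args (upd (upd x i v) ord0 u) (fupd (fupd pr i b) ord0 a).
  move=> j; rewrite /fupd; have [->|j0] := eqVneq j ord0; first by rewrite upd_same.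
  rewrite upd_other //; have [->|ji] := eqVneq j i; first by rewrite upd_same.
  by rewrite upd_other //; apply: weight_args_homog hx j0.
have [s e1 e2] := br_exchange hz i0; exists s.
  by rewrite /slot -e1 exchange_upd.
by move=> ab; move: e2; rewrite /fupd (negPf i0) !eqxx ab => ->.
Qed.

Lemma slot_arg_neq0 x i u : i != ord0 -> slot x ord0 u != 0 -> x i != 0.
Proof.
move=> i0; apply: contraNneq => xi; have := slot_updZ x 0 u i0.
by rewrite !scale0r -xi upd_id => ->.
Qed.

(** No nonzero vector is annihilated by all brackets; here it stands in position
    i1 rather than in position 0. *)
Lemma exists_slot (x0 : F) b0 k : wvec b0 x0 -> x0 != 0 -> hw k x0 ->
  exists x pr mu, [/\ args x pr mu, x i1 = x0, pr i1 = b0, mu i1 = k &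
    exists u, slot x ord0 u != 0].
Proof.
move=> w0 x00 k0; have [S fS hS] := weight_vec_span act simF.
have i1' : ord0 != i1 by rewrite eq_sym.
have [[z [z1 zS zn0]]|H] := pselect (exists z : {ffun 'I_N.+1 -> F},
    [/\ z i1 = x0, forall i, i != i1 -> z i \in S & fs_br z != 0]).
  have /fin_all_exists [pr hpr] (i : 'I_N.+1) : exists b, (i = i1 -> b = b0) /\ wvec b (z i).
    have [->|ii] := eqVneq i i1; first by exists b0; rewrite z1.
    by have [_ [b hb]] := hS _ (zS i ii); exists b; split=> // e; rewrite e eqxx in ii.
  have /fin_all_exists [mu hmu] (i : 'I_N.+1) : exists l, (i = i1 -> l = k) /\ hw l (z i).
    have [->|ii] := eqVneq i i1; first by exists k; rewrite z1.
    have [zi0 [b hb]] := hS _ (zS i ii); have [l hl] := int_weight charK act simF pq npq zi0 hb.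
    by exists l; split=> // e; rewrite e eqxx in ii.
  exists z, pr, mu; split=> //.
  - by move=> i i0; split; [apply: (hpr i).2 | apply: (hmu i).2].
  - exact: (hpr i1).1.
  - exact: (hmu i1).1.
  - by exists (z ord0); rewrite /slot upd_id.
have H1 (z : {ffun 'I_N.+1 -> F}) : z i1 = x0 -> fs_br z = 0.
  move=> z1; apply/eqP; rewrite -memv0; apply: (br_span (S := S) (A := [set i1])) => // y hy hyS.
  rewrite memv0; apply: contrapT => /negP yn; apply: H; exists y; split=> //.
    by rewrite hy ?inE.
  by move=> i ii; rewrite hyS // inE.
case/eqP: x00; apply: (simple_ann simF w0.1) => g [n [c [f [hf ->]]]].
rewrite sum_lfunE big1 // => j _; rewrite scale_lfunE.
have [e [y [r' [_ fE]]]] := is_adE (hf j).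
rewrite (fE _ _ w0.1) (insert_upd x0 y) //.
set z := insert _ _ _; suff -> : fs_br (upd z ord0 x0) = 0 by rewrite !scaler0.
apply/eqP; rewrite -memv0; apply: (br_span (S := S) (A := [set ord0])) => // y' hy hyS.
have y0 : y' ord0 = x0 by rewrite hy ?inE // upd_same.
have /fin_all_exists [pr hpr] (i : 'I_N.+1) : exists b, y' i \in fs_gr F b.
  have [->|i0] := eqVneq i ord0; first by exists b0; rewrite y0; apply: w0.1.
  by have [|_ [b [hb _]]] := hS (y' i); [apply: hyS; rewrite inE | exists b].
have [s e1 _] := br_exchange hpr i1'.
move: e1; rewrite H1; last by rewrite ffunE tpermR.
by move/esym/eqP; rewrite scaler_eq0 signr_eq0 /= memv0.
Qed.

Section TopVector.
Variables (x0 : F) (b0 : bool) (k : int).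
Hypotheses (w0 : wvec b0 x0) (x00 : x0 != 0) (k0 : hw k x0).
Hypothesis top : forall w (l : int), w != 0 -> hw l w -> l <= k.

Definition realizes_e x pr mu (c : K) := [/\ args x pr mu, x i1 = x0 /\ pr i1 = b0, mu i1 = k,
  degree mu = 2 /\ c != 0 & forall u, slot x ord0 u = c *: e_ p q u].

Lemma e_neq0 : exists u, e_ p q u != 0.
Proof.
apply: contrapT => H; have e0 : rho (delta_mx p q) = 0.
  apply/lfunP => u; rewrite zero_lfunE; apply/eqP; apply: contrapT => /negP un.
  by apply: H; exists u.
have /matrixP /(_ p q) := sla_inj act (@strace_delta K r par _ _ npq) e0.
by rewrite !mxE !eqxx => /eqP; rewrite oner_eq0.
Qed.

Lemma realizes_neq0 x pr mu c : realizes_e x pr mu c -> exists u, slot x ord0 u != 0.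
Proof.
case=> _ _ _ [_ c0] h; have [u hu] := e_neq0; exists u.
by rewrite h scaler_eq0 negb_or c0.
Qed.

Lemma degree2_realizes x pr mu : args x pr mu -> x i1 = x0 -> pr i1 = b0 -> mu i1 = k ->
  degree mu = 2 -> (exists u, slot x ord0 u != 0) -> exists c, realizes_e x pr mu c.
Proof.
move=> hx x1 p1 m1 d2 [u hu]; have [c hc] := degree2 charK act pq hx d2.
exists c; split=> //; split=> //; apply: contraNneq hu => c0.
by rewrite hc c0 scale0r.
Qed.

(** The degree of the tuple is at most 2 and is increased by each application of
    [raise_weight_args]. *)
Lemma exists_realizing : exists x pr mu c, realizes_e x pr mu c.
Proof.
have [x [pr [mu [hx x1 p1 m1 sn]]]] := exists_slot w0 x00 k0.
have [n] : exists n : nat, 2 - degree mu <= n%:Z by exists `|2 - degree mu|%N; lia.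
elim: n x pr mu hx x1 p1 m1 sn => [|n IH] x pr mu hx x1 p1 m1 sn le.
  have := degree_bound charK act pq hx sn => /andP [_ le2].
  have d2 : degree mu = 2 by lia.
  by have [c hc] := degree2_realizes hx x1 p1 m1 d2 sn; exists x, pr, mu, c.
have [d2|d2] := eqVneq (degree mu) 2.
  by have [c hc] := degree2_realizes hx x1 p1 m1 d2 sn; exists x, pr, mu, c.
have [i [s [t [i0 ii rst sn']]]] := raise_weight_args charK str1 act pq npq i10 m1 top hx sn d2.
have [st lst] := raising_hcoef npq rst; have [wi hi] := hx i i0.
have hx' := weight_args_upd i hx (weight_vec_e act st wi) (hweight_e act pq st hi).
have ii' : i1 != i by rewrite eq_sym.
apply: IH hx' _ _ _ sn' _.
- by rewrite upd_other.
- by rewrite /fupd (negPf ii').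
- by rewrite /fupd (negPf ii').
- rewrite degree_fupd //; move: (degree mu) (mu i) (hwt s) (hwt t) lst le; clear; lia.
Qed.

Lemma realizes_le_top x pr mu c i : realizes_e x pr mu c -> i != ord0 -> mu i <= k.
Proof.
move=> hg i0; have [u hu] := realizes_neq0 hg; case: hg => hx _ _ _ _.
exact: top (slot_arg_neq0 i0 hu) (hx i i0).2.
Qed.

(** All the weights of the arguments are at most k, and their sum is 2. *)
Lemma top_pos x pr mu c : realizes_e x pr mu c -> 0 < k.
Proof.
move=> hg; rewrite ltNge; apply/negP => kle; have := hg => -[_ _ _ [d2 _] _].
have : degree mu <= 0.
  by apply: sumr_le0 => i i0; apply: le_trans (realizes_le_top hg i0) kle.
by rewrite d2.
Qed.

Lemma top_killed : e_ p q x0 = 0.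
Proof.
apply/eqP; apply: contrapT => /negP n0.
have := top n0 (hweight_e act pq npq k0).
rewrite hcoef_p // hcoef_q //; move: (k); clear; lia.
Qed.

Lemma top_ef : e_ p q (e_ q p x0) = k%:~R *: x0.
Proof. exact: (hweight_ef act pq npq k0 top_killed). Qed.

Lemma f_gr b w : w \in fs_gr F b -> e_ q p w \in fs_gr F b.
Proof. by move=> hw; have := e_gr act neq_qp hw; rewrite pq addbb. Qed.

(** Take a tuple with as many entries x0 as possible, and evaluate the derivation
    f on [x0, x_1, ..., x_(N-1)] = c e x0 = 0.  For odd vectors exchanging
    entries gives no sign, so the slot and every entry x0 contribute the same
    term c k x0. *)
Lemma top_even : b0 = false.
Proof.
apply/negbTE/negP => b01.
pose cnt x := #|[set i | (i != ord0) && (x i == x0)]|.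
pose P n := `[< exists x pr mu c, realizes_e x pr mu c /\ cnt x = n >].
have exP : exists n, P n.
  by have [x [pr [mu [c hg]]]] := exists_realizing; exists (cnt x); apply/asboolP; exists x, pr, mu, c.
have leP n : P n -> (n <= N.+1)%N.
  by move=> /asboolP [x [_ [_ [_ [_ <-]]]]]; rewrite -[X in (_ <= X)%N]card_ord max_card.
case: (ex_maxnP exP leP) => n /asboolP [x [pr [mu [c [hg cx]]]]] maxn.
have := hg => -[hx [x1 p1] m1 [d2 c0] hc]; have kpos := top_pos hg.
have hf0 : e_ q p x0 \in fs_gr F b0 := f_gr w0.1.
have hfi i : i != ord0 -> e_ q p (x i) \in fs_gr F (pr i).
  by move=> i0; apply: f_gr; apply: weight_args_homog hx i0.
have sx i : i != ord0 -> slot (upd x i (e_ q p (x i))) ord0 x0 =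
    if x i == x0 then (c * k%:~R) *: x0 else 0.
  move=> i0; have [xi|xi] := eqVneq (x i) x0.
    rewrite xi; have [s -> es] := slot_swap hx i0 hf0 w0.1.
    have -> : upd x i x0 = x by rewrite -xi upd_id.
    by rewrite es // b01 /= scale1r hc top_ef scalerA.
  (* an entry other than x0 could be replaced with x0, of weight k: the degree
     would exceed 2, or be 2 and contradict the choice of x *)
  have [s -> _] := slot_swap hx i0 (hfi i i0) w0.1.
  apply/eqP; apply: contrapT => /negP; rewrite scaler_eq0 signr_eq0 /= => sn.
  have hx' := weight_args_upd i hx w0 k0.
  have ex : exists u, slot (upd x i x0) ord0 u != 0 by exists (e_ q p (x i)).
  have := degree_bound charK act pq hx' ex; rewrite degree_fupd // d2 => /andP [_ le2].
  have lek := realizes_le_top hg i0.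
  have ii : i1 != i by apply: contraNneq xi => <-; rewrite x1.
  have [||||c' hg'] := degree2_realizes hx' _ _ _ _ ex.
  - by rewrite upd_other.
  - by rewrite /fupd (negPf ii).
  - by rewrite /fupd (negPf ii).
  - by rewrite degree_fupd // d2; move: (mu i) le2 lek; clear; lia.
  have /maxn : P (cnt (upd x i x0)).
    by apply/asboolP; do 4!eexists; split; first exact: hg'.
  rewrite leqNgt -cx => /negP; apply; apply: proper_card; apply/properP; split.
    apply/subsetP => j; rewrite !inE => /andP [-> /eqP xj] /=.
    by have [->|ji] := eqVneq j i; rewrite ?upd_same ?upd_other ?xj.
  by exists i; rewrite !inE i0 ?upd_same ?eqxx.
have [sf hf] : strace par (delta_mx q p : 'M[K]_r) = 0 /\ homog par false (delta_mx q p : 'M[K]_r).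
  split; first exact: strace_delta neq_qp.
  by have := @homog_delta K r par q p; rewrite pq addbb.
have := rho_slot_even act sf hf hx w0.1.
rewrite (eq_bigr (fun i => if x i == x0 then (c * k%:~R) *: x0 else 0)) //.
rewrite -big_mkcondr sumr_const !hc top_killed scaler0 linear0 top_ef scalerA.
rewrite -{1}[_ *: x0]mulr1n -mulrnDr add1n => /esym /eqP.
rewrite -scaler_nat scalerA scaler_eq0 (negPf x00) orbF !mulf_eq0 (negPf c0) /=.
rewrite natr_eq0_char0 // intr_eq0_char0 //= => /eqP k00.
by rewrite k00 in kpos.
Qed.

End TopVector.

(** Put w = f x0.  As e w <> 0, exchanging w with the entry x i gives a nonzero
    operator of weight k - mu i, which is at most 2.  Since the mu i add up to 2,
    and there is a second entry, k <= 2; and if k = 2 then mu i2 = 0, so the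
    operator obtained from the exchange at i2 is a multiple of e and
    e (x i2) <> 0.  The vector e (x i2) has greatest weight, so it is even, and so is
    x i2; but then [x i2, ..., x i2, ...] = 0. *)
Lemma top_is_one (x0 : F) b0 (k : int) (i2 : 'I_N.+1) : i2 != ord0 -> i2 != i1 ->
  wvec b0 x0 -> x0 != 0 -> hw k x0 ->
  (forall w (l : int), w != 0 -> hw l w -> l <= k) -> k = 1.
Proof.
move=> i20 i21 w0 x00 k0 top; have [x [pr [mu [c hg]]]] := exists_realizing w0 x00 k0 top.
have kpos := top_pos top hg; have := hg => -[hx [x1 p1] m1 [d2 c0] hc].
have efx := top_ef k0 top; set w := e_ q p x0 in efx.
have hwt_w : hw (k - 2) w.
  by have := hweight_e act pq neq_qp k0; rewrite hcoef_p // hcoef_q // -addrA.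
have ww : wvec b0 w by have := weight_vec_e act neq_qp w0; rewrite pq addbb.
have kn0 : k%:~R != 0 :> K by rewrite intr_eq0_char0 // gt_eqF.
have sw i : i != ord0 -> slot (upd x i w) ord0 (x i) != 0.
  move=> i0; have [s e _] := slot_swap hx i0 ww.1 (weight_args_homog hx i0).
  rewrite e scaler_eq0 signr_eq0 /= upd_id hc efx scalerA scaler_eq0.
  by rewrite (negPf x00) orbF mulf_eq0 (negPf c0).
have hx' i := weight_args_upd i hx ww hwt_w.
have lo i : i != ord0 -> k - 2 <= mu i.
  move=> i0; have ex : exists u, slot (upd x i w) ord0 u != 0 by exists (x i); apply: sw.
  have := degree_bound charK act pq (hx' i) ex; rewrite degree_fupd // d2.
  by move: (mu i); clear; lia.
have dE : degree mu = k + (mu i2 + \sum_(i | (i != ord0) && (i != i1) && (i != i2)) mu i).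
  by rewrite (bigD1 i1) //= m1 (bigD1 i2) //= i20.
apply/eqP; rewrite eq_le; apply/andP; split; last by move: kpos; clear; lia.
rewrite leNgt; apply/negP => k1.
have rest : 0 <= \sum_(i | (i != ord0) && (i != i1) && (i != i2)) mu i.
  by apply: sumr_ge0 => i /andP [/andP [i0 _] _]; move: k1 (lo i i0); clear; lia.
have lo2 := lo i2 i20.
have [k2 m2] : k = 2 /\ mu i2 = 0.
  move: d2 k1 lo2 rest; rewrite dE; move: (mu i2) (\sum_(_ | _) _).
  by clear; lia.
have [|c' hc'] := degree2 charK act pq (hx' i2) _.
  by rewrite degree_fupd // d2 m2 k2.
have e2 : e_ p q (x i2) != 0.
  by have := sw i2 i20; rewrite hc' scaler_eq0 negb_or => /andP [].
have [wi hi] := hx i2 i20.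
have we : wvec (pr i2) (e_ p q (x i2)).
  by have := weight_vec_e act npq wi; rewrite pq addbb.
have he : hw k (e_ p q (x i2)).
  by have := hweight_e act pq npq hi; rewrite hcoef_p // hcoef_q // m2 k2.
have pr2 := top_even we e2 he top.
have [s e es] := slot_swap hx i20 wi.1 wi.1.
move: e; rewrite upd_id es // pr2 /= scaleN1r hc => /eqP.
rewrite -subr_eq0 opprK -mulr2n -scaler_nat scalerA scaler_eq0 (negPf e2) orbF.
by rewrite mulf_eq0 natr_eq0_char0 //= (negPf c0).
Qed.

Theorem even_root_weights (i2 : 'I_N.+1) : i2 != ord0 -> i2 != i1 ->
  (forall b w (l : int), wvec b w -> w != 0 -> hw l w -> l <= 1 /\ (l = 1 -> b = false)) /\
  (exists (x0 : F) x pr mu (c : K), x0 != 0 /\ realizes_e x0 false 1 x pr mu c).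
Proof.
move=> i20 i21; have [k [b0 [x0 [w0 x00 k0 top]]]] := top_weight charK act simF pq npq.
have k1 := top_is_one i20 i21 w0 x00 k0 top; subst k.
split=> [b w l wb wn hl|].
  split=> [|l1]; first exact: top hl.
  by subst l; apply: top_even wb wn hl top.
have := exists_realizing w0 x00 k0 top; rewrite (top_even w0 x00 k0 top) => -[x [pr [mu [c hg]]]].
by exists x0, x, pr, mu, c.
Qed.

End Top.

(** * Odd vectors *)

Section Final.
Variables (K : closedFieldType) (charK : [pchar K] =i pred0).
Variables (N : nat) (F : filippovSuperalgebra K N.+1) (r : nat) (par : 'I_r -> bool).
Variable rho : {linear 'M[K]_r -> 'End(F)}.
Hypotheses (str1 : strace par (1%:M : 'M[K]_r) != 0) (act : sl_action par rho).
Hypothesis simF : fs_simple F.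
Variables (i1 i2 : 'I_N.+1).
Hypotheses (i10 : i1 != ord0) (i20 : i2 != ord0) (i21 : i2 != i1).
Variables (a0 j0 : 'I_r).
Hypotheses (pa0 : par a0 = false) (pj0 : par j0 = true).
Implicit Types (w : F) (s t u v : 'I_r).

Local Notation e_ s t := (rho (delta_mx s t)).
Local Notation wvec := (weight_vec par rho).
Local Notation hw := (hweight rho).

(** The weight is at most 1 and not 1, both for (s, t) and for (t, s). *)
Lemma odd_zero s t (l : int) w : par s = par t -> s != t -> wvec true w ->
  hw s t l w -> l != 0 -> w = 0.
Proof.
move=> st nst ww hl l0; apply: contrapT => /eqP wn.
have [H _] := even_root_weights charK str1 act simF st nst i10 i20 i21.
have nts : t != s by rewrite eq_sym.
have [H' _] := even_root_weights charK str1 act simF (esym st) nts i10 i20 i21.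
have hl' : hw t s (- l) w.
  by rewrite /hweight /hmatrix -opprB linearN opp_lfunE -/(hmatrix K s t) hl mulrNz scaleNr.
have [le1 n1] := H _ _ _ ww wn hl; have [le2 n2] := H' _ _ _ ww wn hl'.
have l1 : l <> 1 by move/n1.
have l2 : - l <> 1 by move/n2.
by move: l0 le1 le2 l1 l2; clear; lia.
Qed.

Lemma odd_hweight0 s t w : par s = par t -> s != t -> wvec true w -> hw s t 0 w.
Proof.
move=> st nst ww; have [->|wn] := eqVneq w 0; first by rewrite /hweight linear0 scaler0.
have [l hl] := int_weight charK act simF st nst wn ww.
have [<-//|l0] := eqVneq l 0.
by rewrite (odd_zero st nst ww hl l0) eqxx in wn.
Qed.

Lemma odd_e s t w : par s = par t -> s != t -> wvec true w -> e_ s t w = 0.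
Proof.
move=> st nst ww.
have we : wvec true (e_ s t w) by have := weight_vec_e act nst ww; rewrite st addbb.
apply: (odd_zero st nst we (hweight_e act st nst (odd_hweight0 st nst ww))).
by rewrite hcoef_p // hcoef_q.
Qed.

Lemma e_mul_chain s t v w : s != t -> t != v -> s != v ->
  e_ s t (e_ t v w) =
    (-1) ^+ ((par s (+) par t) && (par t (+) par v)) *: e_ t v (e_ s t w) + e_ s v w.
Proof.
move=> st tv sv; rewrite (e_mul act w st tv) eqxx eq_sym (negPf sv).
by rewrite mulr0n scaler0 subr0.
Qed.

Lemma e_mul_cochain s t u w : s != t -> u != s -> t != u ->
  e_ s t (e_ u s w) =
    (-1) ^+ ((par s (+) par t) && (par u (+) par s)) *: (e_ u s (e_ s t w) - e_ u t w).
Proof.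
move=> st us tu; rewrite (e_mul act w st us) eqxx (negPf tu) mulr0n sub0r scalerBr.
by rewrite linearN linearZ /= opp_lfunE scale_lfunE.
Qed.

(** The odd root vectors generate the whole algebra. *)
Lemma odd_generate b w : w \in fs_gr F b ->
  (forall s t, par s != par t -> e_ s t w = 0) -> w = 0.
Proof.
move=> wb H.
have neq s t : par s != par t -> s != t by apply: contraNneq => ->.
apply: (sl_ann_eq0 act simF wb) => X sX; rewrite rho_decomp.
rewrite big1 ?add0r => [|s _]; last first.
  rewrite big1 // => t ts; have [pst|nst] := eqVneq (par s) (par t); last by rewrite H // scaler0.
  have [j pj] : exists j, par j != par s.
    by case E : (par s); [exists a0; rewrite pa0 | exists j0; rewrite pj0].
  have jt : par j != par t by rewrite -pst.
  have sj : par s != par j by rewrite eq_sym.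
  have st : s != t by rewrite eq_sym.
  have := e_mul_chain w (neq _ _ sj) (neq _ _ jt) st.
  by rewrite (H _ _ jt) (H _ _ sj) !linear0 ?scaler0 add0r => <-; rewrite scaler0.
have odd2 s t : par s != par t -> e_ s s w = - e_ t t w.
  move=> st; have nst := neq _ _ st; have nts : t != s by rewrite eq_sym.
  have ts : par t != par s by rewrite eq_sym.
  have := e_mul act w nst nts; rewrite (H _ _ st) (H _ _ ts) !linear0 !eqxx ?scaler0 add0r.
  have -> : (par s (+) par t) && (par t (+) par s) = true.
    by move: st; case: (par s) (par t) => [] [].
  rewrite scaleN1r opprK linearD add_lfunE => /esym /eqP.
  by rewrite addr_eq0 => /eqP.
have sgn s : e_ s s w = - ((-1) ^+ par s *: e_ j0 j0 w).
  case E : (par s); last by rewrite scale1r; apply: odd2; rewrite E pj0.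
  by rewrite scaleN1r opprK (odd2 s a0) ?E ?pa0 // (odd2 a0 j0) ?pa0 ?pj0 // opprK.
rewrite dpart_sum linear_sum sum_lfunE.
rewrite (eq_bigr (fun s => (- ((-1) ^+ par s * X s s)) *: e_ j0 j0 w)); last first.
  by move=> s _; rewrite linearZ /= scale_lfunE [in LHS]sgn scaleNr scalerN scalerA [X s s * _]mulrC.
by rewrite -scaler_suml sumrN -/(strace par X) sX oppr0 scale0r.
Qed.

(** The even root vectors kill w, and a product of two odd root vectors maps w to
    an odd vector, which is 0 unless its weights for the pairs (a, b) and
    (j, k) are. *)
Lemma odd_vec_eq0 w : (forall s, exists2 t, t != s & par t = par s) ->
  wvec true w -> w = 0.
Proof.
move=> H ww; apply: (odd_generate ww.1) => b j pbj.
have [a ab pab] := H b; have [k kj pkj] := H j.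
have neq s t : par s != par t -> s != t by apply: contraNneq => ->.
have paj : par a != par j by rewrite pab.
have pbk : par b != par k by rewrite pkj.
have ba : b != a by rewrite eq_sym. have jk : j != k by rewrite eq_sym.
have aj := neq _ _ paj; have bj := neq _ _ pbj; have bk := neq _ _ pbk.
have ja : j != a by rewrite eq_sym. have jb : j != b by rewrite eq_sym.
have kb : k != b by rewrite eq_sym.
have odd_odd s t u v : par s != par t -> par u != par v -> wvec true (e_ s t (e_ u v w)).
  move=> pst puv; have := weight_vec_e act (neq _ _ pst) (weight_vec_e act (neq _ _ puv) ww).
  by move: pst puv; case: (par s) (par t) (par u) (par v) => [] [] [] [].
have z s t u v c d : par s != par t -> par u != par v -> par c = par d -> c != d ->
    hcoef c d u - hcoef c d v + hcoef c d s - hcoef c d t != 0 -> e_ s t (e_ u v w) = 0.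
  move=> pst puv pcd cd; apply: (odd_zero pcd cd (odd_odd _ _ _ _ pst puv)).
  have := hweight_e act pcd (neq _ _ pst) (hweight_e act pcd (neq _ _ puv) (odd_hweight0 pcd cd ww)).
  by rewrite add0r.
have hE c d s : hcoef c d s = (s == c)%:Z - (s == d)%:Z by [].
have pak : par a != par k by rewrite pab pkj.
have ak := neq _ _ pak; have ka : k != a by rewrite eq_sym.
pose ns := (negPf ab, negPf ba, negPf jk, negPf kj, negPf aj, negPf ja, negPf bj,
            negPf jb, negPf bk, negPf kb, negPf ak, negPf ka).
have pja : par j != par a by rewrite eq_sym.
have pjb : par j != par b by rewrite eq_sym.
have pkb : par k != par b by rewrite eq_sym.
have pjk : par j = par k by [].
have pba : par b = par a by [].
have z1 : e_ b j (e_ a j w) = 0 by apply: (z _ _ _ _ j k) => //; rewrite !hE !eqxx !ns.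
have z2 : e_ b j (e_ b k w) = 0 by apply: (z _ _ _ _ b a) => //; rewrite !hE !eqxx !ns.
have z3 : e_ j a (e_ b j w) = 0 by apply: (z _ _ _ _ a b) => //; rewrite !hE !eqxx !ns.
have z4 : e_ j b (e_ b k w) = 0 by apply: (z _ _ _ _ j k) => //; rewrite !hE !eqxx !ns.
have even_odd (x y : bool) : (x (+) x) && y = false by rewrite addbb.
have odd_even (x y : bool) : y && (x (+) x) = false by rewrite addbb andbF.
have kill c d : par c = par d -> c != d -> e_ c d w = 0 by move=> pcd cd; apply: odd_e.
have kj_bk : e_ k j (e_ b k w) = - e_ b j w.
  by rewrite e_mul_cochain // kill // linear0 sub0r pkj even_odd scale1r.
have ab_bj : e_ a b (e_ b j w) = e_ a j w.
  by rewrite e_mul_chain // (kill a b) // linear0 scaler0 add0r.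
have ba_aj : e_ b a (e_ a j w) = e_ b j w.
  by rewrite e_mul_chain // (kill b a) // linear0 scaler0 add0r.
have Pab : e_ j a (e_ a j w) = e_ j b (e_ b j w).
  have := e_mul_cochain (e_ b j w) ab ja bj.
  by rewrite z3 linear0 ab_bj pab even_odd scale1r => /esym /eqP; rewrite subr_eq0 => /eqP.
have Pjk : e_ k b (e_ b k w) = e_ j b (e_ b j w).
  have := e_mul_chain (e_ b k w) kj jb kb.
  rewrite z4 linear0 kj_bk pkj even_odd scale1r linearN /= => /esym /eqP.
  by rewrite addrC subr_eq0 => /eqP.
have odd2 s t u v : par s != par t -> par u != par v -> (par s (+) par t) && (par u (+) par v).
  by move=> st uv; move: st uv; case: (par s) (par t) (par u) (par v) => [] [] [] [].
have bP1 : e_ b j (e_ j a (e_ a j w)) = e_ b j w.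
  by rewrite e_mul_chain // z1 linear0 scaler0 add0r ba_aj.
have bP2 : e_ b j (e_ k b (e_ b k w)) = - e_ b j w.
  rewrite e_mul_cochain // z2 linear0 sub0r odd2 // scaleN1r opprK.
  by rewrite kj_bk.
have /eqP : e_ b j w = - e_ b j w by rewrite -{1}bP1 Pab -Pjk bP2.
rewrite -subr_eq0 opprK -mulr2n -scaler_nat scaler_eq0 natr_eq0_char0 //= => /eqP.
by [].
Qed.

(** Let v = e_st x0.  An odd root vector maps v to an odd vector, which is 0 unless
    its weight for (p, q) is.  If it is, the root vector commutes with e_st, and
    it maps x0 to an odd vector, which e_st kills. *)
Lemma even_top_killed p q x0 s t : par p = par q -> p != q ->
  wvec false x0 -> hw p q 1 x0 -> par s = par t -> s != t -> par s = par p ->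
  s != p -> s != q -> t != p -> t != q -> e_ s t x0 = 0.
Proof.
move=> pq npq w0 h0 st nst sp nsp nsq ntp ntq.
have we : wvec false (e_ s t x0) by have := weight_vec_e act nst w0; rewrite st addbb.
have he : hw p q 1 (e_ s t x0).
  have := hweight_e act pq nst h0; rewrite /hcoef.
  by rewrite (negPf nsp) (negPf nsq) (negPf ntp) (negPf ntq).
apply: (odd_generate we.1) => u v puv.
have nuv : u != v by apply: contraNneq puv => ->.
have puv1 : par u (+) par v = true by move: puv; case: (par u) (par v) => [] [].
have we' : wvec true (e_ u v (e_ s t x0)).
  by have := weight_vec_e act nuv we; rewrite puv1.
have [l0|] := eqVneq (1 + hcoef p q u - hcoef p q v) 0; last first.
  exact: (odd_zero pq npq we' (hweight_e act pq nuv he)).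
have : u = q \/ v = p.
  move: l0 puv; rewrite /hcoef.
  case: (eqVneq u q) => [|_]; first by left.
  case: (eqVneq v p) => [|_]; first by right.
  by case: (u == p); case: (v == q).
move=> uv.
have vs : v != s.
  case: uv => [uq|-> //]; last by rewrite eq_sym.
  by apply: contraNneq puv => ->; rewrite uq sp pq.
have tu : t != u.
  case: uv => [->//|vp]; apply: contraNneq puv => <-.
  by rewrite vp -st sp.
have wuv : wvec true (e_ u v x0) by have := weight_vec_e act nuv w0; rewrite puv1.
rewrite (e_mul act x0 nuv nst) (negPf vs) (negPf tu) !mulr0n scaler0 subr0.
by rewrite linear0 zero_lfunE addr0 (odd_e st nst wuv) scaler0.
Qed.

(** The arguments giving e contain, besides x0, some u of weight 1.  With w = f u
    one has u = e w, and the exchange of w and x0 shows that u is obtained from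
    x0 by an even matrix of weight 0.  Its root vectors involve only indices
    other than p, q and j, so they kill x0, and u is a multiple of x0.  But the
    bracket is alternating in even arguments. *)
Lemma singleton_class p q j : par p = par q -> p != q -> par p != par j ->
  (forall t, par t = par j -> t = j) -> False.
Proof.
move=> pq npq ppj Hj.
have [H [x0 [x [pr [mu [c [x00 hg]]]]]]] := even_root_weights charK str1 act simF pq npq i10 i20 i21.
have := hg => -[hx [x1 p1] m1 [d2 c0] hc].
have [v0 hv0] := realizes_neq0 act npq hg.
have nqp : q != p by rewrite eq_sym.
have le1 i : i != ord0 -> mu i <= 1.
  move=> in0; have [wi hi] := hx i in0.
  by have [] := H _ _ _ wi (slot_arg_neq0 in0 hv0) hi.
have [i [in0 ii1 mi]] : exists i, [/\ i != ord0, i != i1 & mu i = 1].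
  apply: contrapT => Hi; have : \sum_(i | (i != ord0) && (i != i1)) mu i <= 0.
    apply: sumr_le0 => i /andP [in0 ii1].
    have mn : mu i <> 1 by move=> mi; apply: Hi; exists i.
    by move: (le1 i in0) mn; clear; lia.
  move: d2; rewrite (bigD1 i1) //= m1; move: (\sum_(_ | _) _); clear; lia.
have [wu hu] := hx i in0; rewrite mi in hu.
have un0 := slot_arg_neq0 in0 hv0.
have pri : pr i = false by have [_] := H _ _ _ wu un0 hu; apply.
rewrite pri in wu; set u := x i in wu hu un0.
have eu : e_ p q u = 0.
  apply: contrapT => /eqP en; have := H _ _ _ (weight_vec_e act npq wu) en (hweight_e act pq npq hu).
  by rewrite hcoef_p // hcoef_q // => -[].
pose w := e_ q p u.
have ew : e_ p q w = u by rewrite (hweight_ef act pq npq hu eu) scale1r.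
have ww : wvec false w by have := weight_vec_e act nqp wu; rewrite pq addbb.
have hw_w : hw p q (-1) w by have := hweight_e act pq nqp hu; rewrite hcoef_p // hcoef_q.
have sw : slot x ord0 w = c *: u by rewrite hc ew.
have [w0 h0] := hx i1 i10; rewrite x1 p1 m1 in w0 h0.
have P0 : \big[addb/false]_(i | i != ord0) pr i = false.
  apply/negbTE/negP => Pt.
  have := left_op_gr (fun i i0 => weight_args_homog hx i0) ww.1.
  rewrite (left_opE _ _ ww.1) Pt /= scale1r sw => cu.
  have /eqP := gr_two_parities cu (memvZ c wu.1).
  by rewrite scaler_eq0 (negPf c0) (negPf un0).
have xi1 : upd x i1 x0 = x by rewrite -x1 upd_id.
have [s es _] := slot_swap hx i10 w0.1 ww.1; rewrite xi1 sw in es.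
have hx' := weight_args_upd i1 hx ww hw_w.
have [X [sX hX lX wX]] := weight_args_matrix charK act pq hx'.
have P0' : \big[addb/false]_(i | i != ord0) fupd pr i1 false i = false.
  by rewrite parity_fupd // P0 p1.
have D0 : \sum_(i | i != ord0) fupd mu i1 (-1) i = 0.
  by rewrite degree_fupd // d2 m1.
rewrite D0 in wX; rewrite P0' in lX hX.
have sX0 : slot (upd x i1 w) ord0 x0 = rho X x0.
  by rewrite -lX (left_opE _ _ w0.1) scale1r.
have [d hd] : exists d, rho X x0 = d *: x0.
  have [d dd] : exists d, rho (dpart X) x0 = d *: x0.
    by apply: w0.2; split; [rewrite strace_dpart | exact: dpart_diag].
  exists d; rewrite rho_decomp dd big1 ?add0r // => k _; rewrite big1 // => t tk.
  have [->|Xn] := eqVneq (X k t) 0; first by rewrite scale0r.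
  have pkt : par k = par t.
    by apply/eqP; apply: contraNT Xn => pkt; rewrite hX //; move: pkt; case: (par k) (par t) => [] [].
  have kt : k != t by rewrite eq_sym.
  have wkt := wX k t Xn.
  have pkp : par k = par p.
    have [pkj|pkj] := eqVneq (par k) (par j); last by case: (par k) (par p) (par j) ppj pkj => [] [] [].
    by have kj := Hj k pkj; have tj := Hj t (etrans (esym pkt) pkj); rewrite kj tj eqxx in kt.
  have [kp kq tp tq] : [/\ k != p, k != q, t != p & t != q].
    have nl l : ~~ ((l == p) && (l == q)).
      by apply: contra npq => /andP [/eqP <- /eqP <-].
    have nkt l : ~~ ((k == l) && (t == l)).
      by apply: contra kt => /andP [/eqP -> /eqP ->].
    move: wkt (nl k) (nl t) (nkt p) (nkt q); rewrite /hcoef.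
    by case: (k == p) (k == q) (t == p) (t == q) => [] [] [] [].
  by rewrite (even_top_killed pq npq w0 h0 pkt kt) ?scaler0.
have [d' ud] : exists d', u = d' *: x0.
  exists (c^-1 * ((-1) ^+ s * d)); rewrite -scalerA -scalerA -hd -sX0 -es scalerA.
  by rewrite mulVf // scale1r.
have : slot x ord0 w = 0.
  have i1i : i1 != i by rewrite eq_sym.
  have -> : x = upd x i (d' *: x0) by rewrite -ud /u upd_id.
  rewrite /slot updC // br_updZ.
  set z := upd _ i x0.
  have hz : homog_args z (fupd (fupd pr ord0 false) i false).
    move=> l; rewrite /fupd /z; have [->|li] := eqVneq l i; first by rewrite upd_same; apply: w0.1.
    rewrite upd_other //; have [->|l0] := eqVneq l ord0; first by rewrite upd_same; apply: ww.1.
    by rewrite upd_other //; apply: weight_args_homog hx l0.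
  have [s' e1] := br_exchange hz i1i; rewrite /fupd (negPf i1i) (negPf i10) eqxx p1 => /(_ (erefl _)) s1.
  (* z has the even vector x0 in both positions *)
  have ez : exchange i1 i z = z.
    apply/ffunP => l; rewrite ffunE; case: (tpermP i1 i l) => [->|->|//].
      by rewrite /z upd_same upd_other // upd_other.
    by rewrite /z upd_same upd_other // upd_other.
  move: e1; rewrite ez s1 /= scaleN1r => /eqP.
  rewrite -subr_eq0 opprK -mulr2n -scaler_nat scaler_eq0 natr_eq0_char0 //= => /eqP ->.
  by rewrite scaler0.
by rewrite sw => /eqP; rewrite scaler_eq0 (negPf c0) (negPf un0).
Qed.

Theorem no_sl_action p q : par p = par q -> p != q -> fs_gr F true <> 0%VS -> False.
Proof.
move=> pq npq gt.
have [H|/existsNP [j Hj]] := pselect (forall s, exists2 t, t != s & par t = par s).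
  have [w wn ww] := exists_weight_vec act (introN eqP gt).
  by rewrite (odd_vec_eq0 H ww) eqxx in wn.
have Hj' t : par t = par j -> t = j.
  by move=> tj; apply: contrapT => /eqP nt; apply: Hj; exists t.
apply: (singleton_class pq npq _ Hj'); apply: contra npq => /eqP pj.
by rewrite (Hj' p pj) (Hj' q) // -pq.
Qed.

End Final.

(** * The special linear superalgebra *)

Section SpecialLinear.
Variables (K : fieldType) (m n : nat).
Local Notation mat := 'M[K]_(m.+1 + n.+1).
Implicit Types (X : mat).

Definition index_par (s : 'I_(m.+1 + n.+1)) : bool := (m < s)%N.

Lemma index_par_lshift s : index_par (lshift n.+1 s) = false.
Proof. by rewrite /index_par /= ltnNge -ltnS ltn_ord. Qed.

Lemma index_par_rshift s : index_par (rshift m.+1 s) = true.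
Proof. by rewrite /index_par /= addSn ltnS leq_addr. Qed.

Lemma strace_str X : strace index_par X = str X.
Proof.
rewrite /strace big_split_ord /str /mxtrace -sumrN; congr (_ + _); apply: eq_bigr => s _.
  by rewrite index_par_lshift mul1r !mxE.
by rewrite index_par_rshift mulN1r !mxE.
Qed.

Lemma mem_sl_strace X : (X \in sl_space K m n) = (strace index_par X == 0).
Proof. by rewrite strace_str memv_ker lfunE. Qed.

Lemma strace_one : [pchar K] =i pred0 -> m <> n -> strace index_par (1%:M : mat) != 0.
Proof.
move=> charK mn; rewrite /strace big_split_ord /=.
rewrite (eq_bigr (fun=> 1)) => [|s _]; last by rewrite index_par_lshift mul1r mxE eqxx.
rewrite [X in _ + X](eq_bigr (fun=> -1)) => [|s _]; last first.
  by rewrite index_par_rshift mulN1r mxE eqxx.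
rewrite !sumr_const !card_ord mulNrn !pmulrn -intrB intr_eq0_char0 // subr_eq0.
by apply/eqP => -[].
Qed.

Lemma mat_gr_homog a X : homog index_par a X -> mat_gr a X.
Proof.
by case: a => h; split; apply/matrixP => s t; rewrite !mxE h //
  ?index_par_lshift ?index_par_rshift.
Qed.

End SpecialLinear.

Lemma same_parity_pair (m n : nat) : m <> n ->
  exists p q, @index_par m n p = index_par q /\ p != q.
Proof.
case: m => [|m] mn.
  case: n mn => [//|n] _.
  exists (rshift 1 ord0), (rshift 1 ord_max); split; first by rewrite !index_par_rshift.
  by rewrite (inj_eq (@rshift_inj _ _)).
exists (lshift _ ord0), (lshift _ ord_max); split; first by rewrite !index_par_lshift.
by rewrite (inj_eq (@lshift_inj _ _)).
Qed.

(** On matrices of supertrace 0 the projection to sl is the inverse of the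
    inclusion, so rho is phi. *)
Lemma sl_action_of_type_iso (K : fieldType) (m n N : nat)
    (F : filippovSuperalgebra K N.+1) (phi : {linear sl K m n -> 'End(F)}) :
  type_iso phi ->
  sl_action (@index_par m n) (phi \o vsproj (sl_space K m n)).
Proof.
case=> phi_inj phi_inder phi_gr phi_br.
have val X : strace (@index_par m n) X = 0 -> vsval (vsproj (sl_space K m n) X) = X.
  by move=> sX; rewrite vsprojK // mem_sl_strace sX.
have gr a X : strace (@index_par m n) X = 0 -> homog (@index_par m n) a X ->
    sl_gr a (vsproj (sl_space K m n) X).
  by move=> sX hX; rewrite /sl_gr val //; apply: mat_gr_homog.
split=> [a X sX hX|a b X Y sX sY hX hY|X sX|g] /=.
- exact/phi_gr/gr.
- have gX := gr _ _ sX hX; have gY := gr _ _ sY hY.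
  rewrite -mulnb -phi_br //; congr (phi _); apply: val_inj => /=.
  rewrite -[RHS]/(vsval _) (sl_br_homog gX gY) !val //.
    by rewrite /bracket mulnb.
  exact: strace_bracket.
- move=> h; have : vsproj (sl_space K m n) X = 0 by apply: phi_inj; rewrite h linear0.
  by move=> z; rewrite -[X]val // z.
- rewrite phi_inder; split=> [[x ->]|[X _ ->]]; last by eexists.
  exists (vsval x); last by rewrite /= vsvalK.
  by apply/eqP; rewrite -mem_sl_strace; apply: subvsP.
Qed.

Theorem corollary4p1 (m n : nat) (hmn : m <> n)
    (Phi : closedFieldType) (hchar : [pchar Phi] =i pred0)
    (N : nat) (hN : (3 <= N)%N) :
  ~ exists F : filippovSuperalgebra Phi N,
      [/\ fs_gr F false <> 0%VS,
          fs_gr F true <> 0%VS,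
          fs_simple F &
          exists phi : {linear sl Phi m n -> 'End(F)},
            type_iso phi /\ highest_weight_module phi].
Proof.
case: N hN => [|[|[|N]]] // _ [F [_ F1 simF [phi [iso _]]]].
have act := sl_action_of_type_iso iso.
pose i1 : 'I_N.+3 := Ordinal (isT : (1 < N.+3)%N).
pose i2 : 'I_N.+3 := Ordinal (isT : (2 < N.+3)%N).
have [p [q [pq npq]]] := same_parity_pair hmn.
apply: (@no_sl_action Phi hchar N.+2 F _ _ _ (strace_one hchar hmn) act simF i1 i2 _ _ _
  (lshift n.+1 ord0) (rshift m.+1 ord0) _ _ p q pq npq F1) => //.
exact: index_par_rshift.
Qed.
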